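(* Let $\phi:[0,\infty)\to\mathbb R$ be convex with $\phi(1)=0$ and let $\delta\ge0$. Fix $\pi\in\mathcal A(x_0)$ with conditional value $Z_\pi(b)$, $b\in\mathbb R^m$, and let $\mathcal U_\phi(\mu,\delta)=\{\nu\in\mathcal P(\mathbb R^m): D_\phi(\nu\|\mu)\le\delta\}$. Assume $Z_\pi\in L^1(\mu)$ and $\mathcal U_\phi(\mu,\delta)\ne\emptyset$. Define $$\Phi_{\lambda,\beta}(z):=-(\lambda\phi)^*(\beta-z),\qquad\lambda\ge0,\ \beta\in\mathbb R,$$ where $^*$ denotes the convex conjugate, with the convention $(\lambda\phi)^*(\cdot)=\lambda\,\phi^*(\cdot/\lambda)$ for $\lambda>0$. Then $$\inf_{\nu\in\mathcal U_\phi(\mu,\delta)}\int_{\mathbb R^m}Z_\pi(b)\,\nu(db)=\sup_{\lambda\ge0,\ \beta\in\mathbb R}\left\{\beta-\lambda\delta+\int_{\mathbb R^m}\Phi_{\lambda,\beta}\left(Z_\pi(b)\right)\mu(db)\right\}.$$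
   Context: Setting. $(\Omega,\tilde{\mathcal F},P)$ is a complete probability space supporting an $\mathbb R^{m'}$-valued Brownian motion $W$ and a random vector $B\in\mathbb R^m$, independent of $W$ under $P$, with law $\mu\in\mathcal P(\mathbb R^m)$ (the baseline prior). $\mathcal G_t$ is the augmentation of $\sigma(B,W_s:0\le s\le t)$, and the observation filtration $\mathcal F=(\mathcal F_t)$ satisfies the usual conditions and $\mathcal F_t\subseteq\mathcal G_t$. An admissible control $\pi\in\mathcal A(x_0)$ is an $\mathcal F$-progressively measurable process with values in $U\subset\mathbb R^k$ and $\int_0^T\|\pi_t\|_2^2\,dt<\infty$ $P$-a.s. The controlled state $X^\pi$ solves $dX_t=a(t,B,X_t,\pi_t)\,dt+b(t,B,X_t,\pi_t)^\top dW_t$, $X_0=x_0$ (assumed well-posed with $\mathcal F$-adapted solution). $g,h$ are running and terminal rewards, $\{P^b\}$ is a regular conditional probability of $P$ given $B=b$, and $Z_\pi(b)=E^{P^b}\left[\int_0^T g(t,X_t^\pi,\pi_t)\,dt+h(X_T^\pi)\right]$. All integrability conditions needed for expectations (in particular for $\int Z_\pi\,d\nu$) are assumed. The $\phi$-divergence is $D_\phi(\nu\|\mu)=\int\phi\left(\frac{d\nu}{d\mu}\right)d\mu$ for $\nu\ll\mu$, and $+\infty$ if $\nu\not\ll\mu$. The convex conjugate is taken over the domain $[0,\infty)$: $(\lambda\phi)^*(y)=\sup_{x\ge0}\{xy-\lambda\phi(x)\}$ (so for $\lambda=0$ it is $0$ if $y\le0$ and $+\infty$ if $y>0$).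
   Formalization: For δ = 0 it is additionally assumed that Φ_{λ,β}(Z_π) is μ-integrable for some λ ≥ 0 and β; without this the claim fails, e.g. φ(x) = (x−1)², δ = 0, Z_π in L¹(μ) bounded above but not in L²(μ). *)

(* Defs.v *)
From HB Require Import structures.
From mathcomp Require Import all_boot all_order all_algebra.
From mathcomp Require Import all_classical all_reals all_analysis.

Set Implicit Arguments.
Unset Strict Implicit.
Unset Printing Implicit Defensive.

Import Order.TTheory GRing.Theory Num.Theory.
Import numFieldNormedType.Exports.

Local Open Scope classical_set_scope.
Local Open Scope ring_scope.

(* R^m is [m.-tuple R]; its product sigma-algebra is the Borel one.

   The sigma-algebra carried by [Omega] need not be P-complete.  The complete
   space is (Omega, P-completion): its null sets are the [P.-negligible] sets,
   which enter every filtration below.  A complete [Omega] is a special case;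
   allowing an incomplete one matters because a regular conditional probability
   is in general only available on the uncompleted sigma-algebra. *)

(* Filtrations are families of set systems.  [F t] is turned into a measurable
   type by [g_sigma_algebraType], which generates nothing new when [F t] is
   already a sigma-algebra. *)

Definition past {R : realType} {d d' : measure_display}
    {Omega : measurableType d} {V : measurableType d'}
    (W : R -> Omega -> V) (t : R) : set (set Omega) :=
  <<s [set E | exists s (A : set V),
        [/\ 0 <= s <= t, measurable A & E = W s @^-1` A]] >>.

Definition driving_filtration {R : realType} {d d1 d2 : measure_display}
    {Omega : measurableType d} {V1 : measurableType d1}
    {V2 : measurableType d2} (P : probability Omega R)
    (B : Omega -> V1) (W : R -> Omega -> V2) (t : R) : set (set Omega) :=
  <<s preimage_set_system setT B measurable `|` past W t
      `|` P.-negligible >>.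

Definition usual_conditions {R : realType} {d : measure_display}
    {Omega : measurableType d} (P : probability Omega R) (T : R)
    (F : R -> set (set Omega)) : Prop :=
  [/\ forall t, 0 <= t <= T -> sigma_algebra setT (F t),
      forall s t, 0 <= s -> s <= t -> t <= T -> F s `<=` F t,
      P.-negligible `<=` F 0
    & forall t, 0 <= t < T -> \bigcap_(s in `]t, T]) F s `<=` F t].

Definition adapted {R : realType} {d d' : measure_display}
    {Omega : measurableType d} {V : measurableType d'} (T : R)
    (F : R -> set (set Omega)) (X : R -> Omega -> V) : Prop :=
  forall t, 0 <= t <= T ->
    measurable_fun setT (X t : g_sigma_algebraType (F t) -> V).

Definition progressively_measurable {R : realType} {d d' : measure_display}
    {Omega : measurableType d} {V : measurableType d'} (T : R)
    (F : R -> set (set Omega)) (X : R -> Omega -> V) : Prop :=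
  forall t, 0 <= t <= T ->
    measurable_fun (`[0, t]%classic `*` setT)
      (fun p : R * g_sigma_algebraType (F t) => X p.1 p.2).

(* The last clause says that W_t - W_s is independent of sigma(W_r, r <= s)
   with law N(0, (t - s) I). *)
Definition brownian_motion {R : realType} {d : measure_display}
    {Omega : measurableType d} (P : probability Omega R) (T : R) (m' : nat)
    (W : R -> Omega -> m'.-tuple R) : Prop :=
  [/\ forall t, 0 <= t <= T -> measurable_fun setT (W t),
      {ae P, forall w, forall j, tnth (W 0 w) j = 0},
      {ae P, forall w, forall j,
        {within `[0, T], continuous (fun t => tnth (W t w) j)}}
    & forall s t, 0 <= s -> s < t -> t <= T ->
      forall E, past W s E ->
      forall A : 'I_m' -> set R, (forall j, measurable (A j)) ->
      P (E `&` [set w | forall j, A j (tnth (W t w) j - tnth (W s w) j)])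
      = (P E * \prod_(j < m') normal_prob 0 (Num.sqrt (t - s)) (A j))%E].

Definition indep_of_process {R : realType} {d d1 d2 : measure_display}
    {Omega : measurableType d} {V1 : measurableType d1}
    {V2 : measurableType d2} (P : probability Omega R) (T : R)
    (B : Omega -> V1) (W : R -> Omega -> V2) : Prop :=
  forall (A : set V1) (E : set Omega), measurable A -> past W T E ->
    P (B @^-1` A `&` E) = (P (B @^-1` A) * P E)%E.

Definition sqnorm2 {R : realType} {k : nat} (x : k.-tuple R) : R :=
  \sum_(i < k) tnth x i ^+ 2.

Definition admissible {R : realType} {d : measure_display}
    {Omega : measurableType d} (P : probability Omega R) (T : R)
    (F : R -> set (set Omega)) {k : nat} (U : set (k.-tuple R))
    (pi : R -> Omega -> k.-tuple R) : Prop :=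
  [/\ progressively_measurable T F pi,
      forall t w, 0 <= t <= T -> U (pi t w)
    & {ae P, forall w,
        (\int[lebesgue_measure]_(t in `[0%R, T]) (sqnorm2 (pi t w))%:E
          < +oo)%E}].

(* The simple integrand
     sum_(i < sp_size) sp_val i * 1_(sp_time i, sp_time (i + 1)]. *)
Record simple_process (R : realType) (Omega : Type) (m' : nat) := SimpleProcess {
  sp_size : nat;
  sp_time : nat -> R;
  sp_val : nat -> Omega -> m'.-tuple R
}.

Definition simple_adapted {R : realType} {d : measure_display}
    {Omega : measurableType d} (T : R) (G : R -> set (set Omega)) {m' : nat}
    (S : simple_process R Omega m') : Prop :=
  forall i, (i < sp_size S)%N ->
    [/\ 0 <= sp_time S i, sp_time S i <= sp_time S i.+1, sp_time S i.+1 <= T,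
        measurable_fun setT
          (sp_val S i : g_sigma_algebraType (G (sp_time S i)) -> m'.-tuple R)
      & exists M : R, forall w j, `|tnth (sp_val S i w) j| <= M].

Definition simple_eval {R : realType} {Omega : Type} {m' : nat}
    (S : simple_process R Omega m') (t : R) (w : Omega) : m'.-tuple R :=
  [tuple \sum_(i < sp_size S)
     (if sp_time S i < t <= sp_time S i.+1 then tnth (sp_val S i w) j else 0)
   | j < m'].

Definition simple_integral {R : realType} {Omega : Type} {m' : nat}
    (W : R -> Omega -> m'.-tuple R) (S : simple_process R Omega m')
    (t : R) (w : Omega) : R :=
  \sum_(i < sp_size S) \sum_(j < m') tnth (sp_val S i w) j *
    (tnth (W (Num.min t (sp_time S i.+1)) w) j
     - tnth (W (Num.min t (sp_time S i)) w) j).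

(* [I] is the Ito integral of the row vector [H] against [W] on [0, T]: the
   uniform limit of integrals of simple integrands S_n such that
   int_0^T |S_n - H|^2 dt --> 0.  Both limits are usually taken in probability;
   passing to a subsequence, they may be taken almost surely. *)
Definition ito_integral {R : realType} {d : measure_display}
    {Omega : measurableType d} (P : probability Omega R) (T : R)
    (G : R -> set (set Omega)) {m' : nat} (W : R -> Omega -> m'.-tuple R)
    (H : R -> Omega -> m'.-tuple R) (I : R -> Omega -> R) : Prop :=
  {ae P, forall w, measurable_fun `[0, T]%classic (H ^~ w) /\
    (\int[lebesgue_measure]_(t in `[0%R, T]) (sqnorm2 (H t w))%:E < +oo)%E} /\
  exists S : nat -> simple_process R Omega m',
    [/\ forall n, simple_adapted T G (S n),
        {ae P, forall w,
          (\int[lebesgue_measure]_(t in `[0%R, T])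
            (\sum_(j < m')
               (tnth (simple_eval (S n) t w) j - tnth (H t w) j) ^+ 2)%:E)%E
          @[n --> \oo] --> 0%E}
      & {ae P, forall w, forall e : R, 0 < e ->
          \forall n \near \oo, forall t, 0 <= t <= T ->
            `|simple_integral W (S n) t w - I t w| <= e}].

(* dX_t = a(t, B, X_t, pi_t) dt + b(t, B, X_t, pi_t)^T dW_t, X_0 = x0. *)
Definition solves_sde {R : realType} {d : measure_display}
    {Omega : measurableType d} (P : probability Omega R) (T : R)
    {m m' n k : nat} (B : Omega -> m.-tuple R) (W : R -> Omega -> m'.-tuple R)
    (F : R -> set (set Omega))
    (a : R -> m.-tuple R -> n.-tuple R -> k.-tuple R -> n.-tuple R)
    (b : R -> m.-tuple R -> n.-tuple R -> k.-tuple R -> 'M[R]_(m', n))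
    (x0 : n.-tuple R) (pi : R -> Omega -> k.-tuple R)
    (X : R -> Omega -> n.-tuple R) : Prop :=
  [/\ adapted T F X,
      {ae P, forall w, forall i,
        {within `[0, T], continuous (fun t => tnth (X t w) i)}},
      {ae P, forall w, forall i,
        lebesgue_measure.-integrable `[0, T]%classic
          (fun t => (tnth (a t (B w) (X t w) (pi t w)) i)%:E)}
    & forall i, exists I : R -> Omega -> R,
        ito_integral P T (driving_filtration P B W) W
          (fun t w => [tuple b t (B w) (X t w) (pi t w) j i | j < m']) I /\
        {ae P, forall w, forall t, 0 <= t <= T ->
          tnth (X t w) i = tnth x0 i
            + \int[lebesgue_measure]_(s in `[0, t])
                tnth (a s (B w) (X s w) (pi s w)) i
            + I t w}].

Definition regular_conditional {R : realType} {d d' : measure_display}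
    {Omega : measurableType d} {V : measurableType d'}
    (P : probability Omega R) (B : Omega -> V) (mu : probability V R)
    (Pb : R.-pker V ~> Omega) : Prop :=
  forall (A : set Omega) (C : set V), measurable A -> measurable C ->
    P (A `&` B @^-1` C) = (\int[mu]_(b in C) Pb b A)%E.

Definition payoff {R : realType} {Omega : Type} {n k : nat} (T : R)
    (g : R -> n.-tuple R -> k.-tuple R -> R) (h : n.-tuple R -> R)
    (pi : R -> Omega -> k.-tuple R) (X : R -> Omega -> n.-tuple R)
    (w : Omega) : R :=
  \int[lebesgue_measure]_(t in `[0, T]) g t (X t w) (pi t w) + h (X T w).

(* Integrability with respect to the completion of Q.  For such an [f] the
   library integral of [f] against Q, being a supremum over Q-measurable simple
   functions, is the integral against the completion. *)
Definition completion_integrable {R : realType} {d : measure_display}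
    {Omega : measurableType d} (Q : set Omega -> \bar R) (f : Omega -> R) :
    Prop :=
  exists2 f0 : Omega -> R, Q.-integrable setT (EFin \o f0)
    & {ae Q, forall w, f w = f0 w}.

Definition conditional_value {R : realType} {d d' : measure_display}
    {Omega : measurableType d} {V : measurableType d'}
    (Pb : R.-pker V ~> Omega) (Y : Omega -> R) (b : V) : R :=
  fine (\int[Pb b]_w (Y w)%:E).

(* [Radon_Nikodym_SigmaFinite.f] is the everywhere nonnegative version of the
   density d nu / d mu, so only the values of [phi] on [0, +oo) matter. *)
Definition phi_divergence {R : realType} {d : measure_display}
    {V : measurableType d} (phi : R -> R) (nu mu : probability V R) : \bar R :=
  if `[< nu `<< mu >]
  then (\int[mu]_b (phi (fine (Radon_Nikodym_SigmaFinite.f nu mu b)))%:E)%E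
  else +oo%E.

Definition divergence_ball {R : realType} {d : measure_display}
    {V : measurableType d} (phi : R -> R) (mu : probability V R) (delta : R) :
    set (probability V R) :=
  [set nu | (phi_divergence phi nu mu <= delta%:E)%E].

Definition conjugate {R : realType} (psi : R -> R) (y : R) : \bar R :=
  ereal_sup [set (x * y - psi x)%:E | x in [set x | 0 <= x]].

Definition Phi {R : realType} (phi : R -> R) (lambda beta z : R) : \bar R :=
  (- conjugate (fun x => lambda * phi x)%R (beta - z)%R)%E.

(* Main.v *)
Require Import Defs.
From HB Require Import structures.
From mathcomp Require Import all_boot all_order all_algebra.
From mathcomp Require Import all_classical all_reals all_analysis.
From mathcomp Require Import measurable_realfun.
From mathcomp Require Import ring lra.

Import Order.TTheory GRing.Theory Num.Theory.
Import numFieldNormedType.Exports.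

Local Open Scope classical_set_scope.
Local Open Scope ring_scope.

Set Implicit Arguments.
Unset Strict Implicit.
Unset Printing Implicit Defensive.

(** Weak duality integrates [Phi(Z) <= lambda phi(f) + f (Z - beta)], where [f]
    is the density of [nu].

    For the converse only densities with finitely many values are needed. When
    [delta > 0] the constant density 1 is a Slater point, so [lambda] and then
    [beta] come from two separations in the plane, and the infimum over such
    densities moves inside the integral because their values can be chosen,
    point by point, among finitely many rationals.

    When [delta = 0] optimal multipliers need not exist. Subtracting from [phi]
    an affine minorant touching it at 1 leaves some [psi >= 0] with
    [psi 1 = 0], and the ball consists of the densities with values in the
    interval [J] where [psi] vanishes. As [lambda] grows, [Phi] increases to the
    infimum over [J], and the integrability hypothesis allows passing to the
    limit. If 1 is interior to [J], the multiplier [beta] again comes from a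
    separation. Otherwise the ball contains only [mu], and the mean of [Z] is
    reached as [beta] tends to infinity in the appropriate direction, or at the
    given [beta] when [psi] vanishes on all of [1, +oo). *)

(** * Convexity on the half-line: separation, support, measurability *)

Section convex_real.
Context {R : realType}.
Implicit Types (X : set R) (F : R -> R).

Definition segment_closed X := forall t x y, 0 <= t <= 1 -> X x -> X y ->
  X (t * x + (1 - t) * y).

Definition convex_on X F := forall t x y, 0 <= t <= 1 -> X x -> X y ->
  F (t * x + (1 - t) * y) <= t * F x + (1 - t) * F y.

Lemma convex_functionP (D : set R) F : convex_function D F -> convex_on D F.
Proof.
move=> Fc t x y /andP[t0 t1] Dx Dy.
by have := Fc (Itv01 t0 t1) x y (mem_set Dx) (mem_set Dy).
Qed.

Lemma segment_closed_ge0 : segment_closed [set x : R | 0 <= x].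
Proof.
move=> t x y /andP[t0 t1] /= x0 y0.
by rewrite addr_ge0 // mulr_ge0 // subr_ge0.
Qed.

(* The slope [l] exists because, by convexity, every
   ratio [- w / u] with [0 < u] is below every such ratio with [u < 0]. *)
Lemma slope_exists (S : R -> R -> Prop) :
  (forall t u1 w1 u2 w2, 0 <= t <= 1 -> S u1 w1 -> S u2 w2 ->
    exists2 w, S (t * u1 + (1 - t) * u2) w & w <= t * w1 + (1 - t) * w2) ->
  (forall w, S 0 w -> 0 <= w) ->
  (exists u w, S u w /\ u < 0) -> (exists u w, S u w /\ 0 < u) ->
  exists l, forall u w, S u w -> 0 <= w + l * u.
Proof.
move=> Sc S0 [u2 [w2 [S2 u20]]] [u1 [w1 [S1 u10]]].
have cross a b c e : S a b -> 0 < a -> S c e -> c < 0 -> - b / a <= - e / c.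
  move=> Sab a0 Sce c0.
  have ac : 0 < a - c by lra.
  (* The weight at which the segment joining the two points crosses abscissa 0. *)
  pose t := - c / (a - c).
  have t01 : 0 <= t <= 1.
    apply/andP; split; first by apply: divr_ge0; lra.
    by rewrite /t ler_pdivrMr //; lra.
  have [w Sw wle] := Sc _ _ _ _ _ t01 Sab Sce.
  have tE : t * a + (1 - t) * c = 0 by rewrite /t; field; lra.
  rewrite tE in Sw; have := le_trans (S0 _ Sw) wle => {}wle.
  have : 0 <= (- c * b + a * e) / (a - c).
    rewrite (_ : _ / _ = t * b + (1 - t) * e) // /t; field; lra.
  rewrite pmulr_lge0 ?invr_gt0 // => h.
  have -> : - e / c = e / (- c) by field; lra.
  rewrite ler_pdivrMr // mulrAC ler_pdivlMr; nra.
pose A := [set - p.2 / p.1 | p in [set p : R * R | S p.1 p.2 /\ 0 < p.1]].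
have Aub c e : S c e -> c < 0 -> ubound A (- e / c).
  by move=> Sce c0 _ [[a b] /= [Sab a0] <-]; exact: cross Sab a0 Sce c0.
have A0 : A !=set0 by exists (- w1 / u1), (u1, w1).
have Ahub : has_ubound A by exists (- w2 / u2); exact: Aub.
exists (sup A) => u w Suw.
have [u0|u0|u0] := ltgtP u 0.
- have := ge_sup A0 (Aub _ _ Suw u0).
  by rewrite ler_ndivlMr // => ?; lra.
- have : - w / u <= sup A by apply: ub_le_sup => //; exists (u, w).
  by rewrite ler_pdivrMr // => ?; lra.
- by move: Suw; rewrite u0 mulr0 addr0 => /S0.
Qed.

(** A supporting line at 1: [slope_exists] is applied to the graph of [F], translated so that 1
    becomes the origin. *)
Lemma convex_minorant F (Fc : convex_on [set x | 0 <= x] F) :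
  F 1 = 0 -> exists s, forall x, 0 <= x -> s * (x - 1) <= F x.
Proof.
move=> F1; pose S u w := 0 <= u + 1 /\ w = F (u + 1).
have [|w||| l lP] := @slope_exists S.
- move=> t u1 w1 u2 w2 t01 [u10 ->] [u20 ->].
  exists (F (t * (u1 + 1) + (1 - t) * (u2 + 1))); last exact: Fc.
  have E : t * u1 + (1 - t) * u2 + 1 = t * (u1 + 1) + (1 - t) * (u2 + 1) by ring.
  by split; rewrite E //; exact: segment_closed_ge0.
- by move=> [_ ->]; rewrite add0r F1.
- by exists (-1), (F (-1 + 1)); split; [split=> //; lra|lra].
- by exists 1, (F (1 + 1)); split; [split=> //; lra|lra].
exists (- l) => x x0; have := lP (x - 1) (F x); rewrite /S subrK => /(_ _).
by move=> /(_ (conj x0 erefl)); lra.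
Qed.

Lemma convex_sub_affine X F s : convex_on X F ->
  convex_on X (fun x => F x - s * (x - 1)).
Proof. by move=> Fc t x y t01 Xx Xy /=; have := Fc t x y t01 Xx Xy; lra. Qed.

(** Sublevel sets of a convex function are intervals, hence Borel; this also covers a jump of [F] at
    0. *)
Lemma convex_measurable_comp d (V : measurableType d) F (f : V -> R) :
  convex_on [set x | 0 <= x] F -> measurable_fun setT f ->
  (forall v, 0 <= f v) -> measurable_fun setT (F \o f).
Proof.
move=> Fc mf f0.
apply: (measurability (@RGenInftyO.G R)) => [|_ [_ [r ->] <-]].
  exact: RGenInftyO.measurableE.
rewrite (_ : _ @^-1` _ = f @^-1` [set x | 0 <= x /\ F x < r]); last first.
  apply/seteqP; split=> v /=; rewrite in_itv/=; first by split.
  by case.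
apply: mf => //; apply: is_interval_measurable.
move=> x y /= [x0 Fx] [y0 Fy] z /andP[xz zy].
split; first exact: le_trans xz.
have [xy|xy] := eqVneq x y.
  by have -> : z = x by lra.
have yx : 0 < y - x by rewrite subr_gt0 lt_neqAle xy (le_trans xz).
pose t := (y - z) / (y - x).
have t01 : 0 <= t <= 1.
  by apply/andP; split; [apply: divr_ge0|rewrite ler_pdivrMr //]; lra.
have := Fc t x y t01 x0 y0.
have -> : t * x + (1 - t) * y = z by rewrite /t; field; lra.
move/le_lt_trans; apply; case/andP: t01 => t0 t1.
apply: (@le_lt_trans _ _ (Num.max (F x) (F y))); last by rewrite gt_max Fx Fy.
have : F x <= Num.max (F x) (F y) by rewrite le_max lexx.
have : F y <= Num.max (F x) (F y) by rewrite le_max lexx orbT.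
by nra.
Qed.

End convex_real.

(** * Functions with finitely many values *)

Section step_functions.
Context {R : realType} {d : measure_display} {V : measurableType d}.
Implicit Types (X : set R) (f g : V -> R).

Definition step X f :=
  [/\ measurable_fun setT f, finite_set (range f) & forall v, X (f v)].

Lemma step_cst X x : X x -> step X (fun=> x).
Proof.
move=> Xx; split=> //; apply: (@sub_finite_set _ _ [set x]) => //.
by move=> _ [v _ <-].
Qed.

Lemma step_sub X Y f : X `<=` Y -> step X f -> step Y f.
Proof. by move=> XY [mf ff Xf]; split=> // v; exact: XY. Qed.

Lemma step_if X (c : V -> bool) f g : measurable_fun setT c ->
  step X f -> step X g -> step X (fun v => if c v then f v else g v).
Proof.
move=> mc [mf ff Xf] [mg fg Xg]; split.
- exact: measurable_fun_ifT.
- apply: (@sub_finite_set _ _ (range f `|` range g)).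
    by move=> _ [v _ <-]; case: ifP => _; [left|right]; exists v.
  by rewrite finite_setU.
- by move=> v; case: ifP.
Qed.

(** [F] is arbitrary: a preimage under [F] matters only through its intersection with the finite
    range of [f], which is Borel. *)
Lemma step_comp X f (F : R -> R) : step X f -> step setT (F \o f).
Proof.
move=> [mf ff _]; split=> //.
- move=> _ A mA; rewrite setTI.
  rewrite (_ : _ @^-1` _ = setT `&` f @^-1` (range f `&` F @^-1` A)).
  apply: mf => //; apply: countable_measurable => //.
    by apply: finite_set_countable; exact: finite_setIl.
  by rewrite setTI; apply/seteqP; split=> v /=; [move=> ?; split=> //; exists v|case].
- apply: (@sub_finite_set _ _ (F @` range f)); last exact: finite_image.
  by move=> _ [v _ <-]; exists (f v) => //; exists v.
Qed.

Lemma step_conv X f g t : segment_closed X -> 0 <= t <= 1 ->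
  step X f -> step X g -> step X (fun v => t * f v + (1 - t) * g v).
Proof.
move=> cX t01 [mf ff Xf] [mg fg Xg]; split.
- by apply: measurable_funD; apply: measurable_funM.
- apply: (@sub_finite_set _ _
    [set t * x + (1 - t) * y | x in range f & y in range g]).
    by move=> _ [v _ <-]; exists (f v); [exists v|exists (g v)=> //; exists v].
  exact: finite_image2.
- by move=> v; exact: cX.
Qed.

Lemma step_bounded X f : step X f -> exists M, forall v, `|f v| <= M.
Proof.
move=> sf; have [_ fin _] := step_comp (@Num.norm R R) sf.
have [s sE] := (finite_seqP _).1 fin.
exists (\sum_(x <- s) `|x|) => v.
have : `|f v| \in s.
  have : range (@Num.norm R R \o f) (`|f v|) by exists v.
  by rewrite sE.
elim: s {sE} => // a s IH; rewrite inE big_cons => /orP[/eqP <-|/IH h].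
  by rewrite normr_id lerDl sumr_ge0.
by rewrite (le_trans h) // lerDr.
Qed.

End step_functions.

(** * Integrals of real and extended real functions *)

Section integral_tools.
Context {R : realType} {d : measure_display} {V : measurableType d}.
Context (mu : {measure set V -> \bar R}).

Lemma EFin_Rintegral (f : V -> R) : mu.-integrable setT (EFin \o f) ->
  (\int[mu]_v f v)%:E = (\int[mu]_v (f v)%:E)%E.
Proof. by move=> fi; rewrite fineK // integrable_fin_num. Qed.

(** Positive and negative parts are compared separately, so that infinite integrals are allowed;
    that of [Phi] may be -oo. *)
Lemma measurable_le_integral (f g : V -> \bar R) :
  measurable_fun setT f -> measurable_fun setT g ->
  (forall v, (f v <= g v)%E) -> (\int[mu]_v f v <= \int[mu]_v g v)%E.
Proof.
move=> mf mg fg; rewrite integralE [leRHS]integralE leeB //.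
- apply: ge0_le_integral => //; try exact: measurable_funepos.
  by move=> v vT; apply: (@funepos_le _ _ setT); [move=> *; exact: fg|exact: mem_set].
- apply: ge0_le_integral => //; try exact: measurable_funeneg.
  by move=> v vT; apply: (@funeneg_le _ _ setT); [move=> *; exact: fg|exact: mem_set].
Qed.

Lemma integrableZl_EFin (k : R) (f : V -> R) :
  mu.-integrable setT (EFin \o f) ->
  mu.-integrable setT (EFin \o (fun v => k * f v)).
Proof.
by move=> /(integrableZl measurableT k); apply: eq_integrable => // v _.
Qed.

Lemma integrableD_EFin (f g : V -> R) :
  mu.-integrable setT (EFin \o f) -> mu.-integrable setT (EFin \o g) ->
  mu.-integrable setT (EFin \o (fun v => f v + g v)).
Proof.
by move=> fi gi; apply: eq_integrable (integrableD measurableT fi gi).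
Qed.

Lemma integrableB_EFin (f g : V -> R) :
  mu.-integrable setT (EFin \o f) -> mu.-integrable setT (EFin \o g) ->
  mu.-integrable setT (EFin \o (fun v => f v - g v)).
Proof.
by move=> fi gi; apply: eq_integrable (integrableB measurableT fi gi).
Qed.

(** Monotone convergence for the increasing non-negative functions [u 0 - u n]. The common lower
    bound [w] makes their limit [H] integrable, so that it can be subtracted from [u 0] again. *)
Lemma nonincreasing_limit_integral (u : nat -> V -> R) (G : V -> \bar R) w :
  (forall n, mu.-integrable setT (EFin \o u n)) ->
  (forall n v, u n.+1 v <= u n v) ->
  (forall v, (u n v)%:E @[n --> \oo] --> G v) ->
  (forall n, w <= \int[mu]_v u n v) ->
  (w%:E <= \int[mu]_v G v)%E.
Proof.
move=> ui nu uG wu.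
have mono v : {homo (u ^~ v) : n m / (n <= m)%N >-> m <= n}.
  by apply/nonincreasing_seqP => n; exact: nu.
pose h n v := ((u 0%N v)%:E - (u n v)%:E)%E.
have mh n : measurable_fun setT (h n).
  by apply: emeasurable_funB; exact: measurable_int (ui _).
have h0 n v : (0 <= h n v)%E by rewrite sube_ge0 // lee_fin mono.
have ndh v : nondecreasing_seq (h ^~ v).
  by move=> n m nm; rewrite leeB // lee_fin mono.
pose H v := ((u 0%N v)%:E - G v)%E.
have hH v : h n v @[n --> \oo] --> H v.
  apply: cvgeB; [exact: fin_num_adde_defr|exact: cvg_cst|exact: uG].
have H0 v : (0 <= H v)%E.
  rewrite -(cvg_lim _ (hH v)) //; apply: lime_ge; last exact: nearW.
  by apply/cvg_ex; eexists; exact: hH.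
have mH : measurable_fun setT H.
  by apply: (emeasurable_fun_cvg h) => // v _; exact: hH.
have iH : (\int[mu]_v H v <= ((\int[mu]_v u 0%N v) - w)%:E)%E.
  have cvI := @cvg_monotone_convergence _ _ _ mu setT measurableT h mh
    (fun n v _ => h0 n v) (fun v _ => ndh v).
  have -> : (\int[mu]_v H v)%E = (\int[mu]_v limn (h ^~ v))%E.
    by apply: eq_integral => v _; apply/esym/cvg_lim => //; exact: hH.
  rewrite -(cvg_lim _ cvI) //; apply: lime_le; first by apply/cvg_ex; eexists; exact: cvI.
  near=> n; rewrite integralB_EFin //; last first.
  by rewrite -!EFin_Rintegral // -EFinB lee_fin lerB.
have Hi : mu.-integrable setT H.
  apply/integrableP; split => //; under eq_integral do rewrite gee0_abs //.
  by rewrite (le_lt_trans iH) ?ltry.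
have -> : (\int[mu]_v G v = \int[mu]_v ((EFin \o u 0%N) \- H) v)%E.
  apply: eq_integral => v _ /=; rewrite /H.
  by case: (G v) => [r||] //=; rewrite -?EFinB ?subKr.
rewrite integralB // -EFin_Rintegral // leeBrDr ?integrable_fin_num //.
by rewrite addeC -leeBrDr // -EFinB.
Unshelve. all: by end_near. Qed.

End integral_tools.

(** * Minimising integrals over finitely valued functions *)

Section step_integrals.
Context {R : realType} {d : measure_display} {V : measurableType d}.
Context (mu : probability V R).
Implicit Types (X : set R) (f Z : V -> R) (F : R -> R).

Lemma step_bounded_fun X f : step X f -> [bounded f v | v in setT].
Proof.
move=> /step_bounded[M Mf]; exists M; split; first exact: num_real.
by move=> x Mx v _ /=; apply: (le_trans (Mf v)); exact: ltW.
Qed.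

Lemma step_integrable X f : step X f -> mu.-integrable setT (EFin \o f).
Proof.
move=> sf; apply: measurable_bounded_integrable => //.
- by rewrite [X in (X < _)%E](probability_setT mu) ltry.
- by case: sf.
- exact: (step_bounded_fun sf).
Qed.

Lemma stepM_integrable X f Z : mu.-integrable setT (EFin \o Z) -> step X f ->
  mu.-integrable setT (EFin \o (fun v => f v * Z v)).
Proof.
move=> Zi sf; have mf : measurable_fun setT f by case: sf.
by apply: eq_integrable (integrableMr measurableT mf (step_bounded_fun sf) Zi).
Qed.

(* [f n v] minimises [F x + x * Z v] over [x = q 0, ..., q n]; these minima
   decrease to the infimum. *)
Lemma step_interchange X F (q : nat -> R) Z w : (forall n, X (q n)) ->
  mu.-integrable setT (EFin \o Z) ->
  (forall f, step X f -> w <= \int[mu]_v (F (f v) + f v * Z v)) ->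
  (w%:E <= \int[mu]_v
     ereal_inf (range (fun n => (F (q n) + q n * Z v)%:E)))%E.
Proof.
move=> Xq Zi wP.
pose C x v := F x + x * Z v.
pose f := fix f n v := if n is n'.+1 then
  (if C (q n) v < C (f n' v) v then q n else f n' v) else q 0%N.
have mZ : measurable_fun setT Z by apply/measurable_EFinP; exact: measurable_int Zi.
have mC g : step X g -> measurable_fun setT (fun v => C (g v) v).
  move=> sg; apply: measurable_funD; first by case: (step_comp F sg).
  by apply: measurable_funM => //; case: sg.
have sf n : step X (f n).
  elim: n => [|n IH] /=; first exact: step_cst.
  apply: step_if => //; last exact: step_cst.
  by apply: measurable_fun_ltr; apply: mC => //; exact: step_cst.
have Ci n : mu.-integrable setT (EFin \o (fun v => C (f n v) v)).
  apply: integrableD_EFin; last exact: stepM_integrable.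
  exact: step_integrable (step_comp F (sf n)).
have ni n v : C (f n.+1 v) v <= C (f n v) v.
  by rewrite /=; case: ifPn => // /ltW.
apply: (nonincreasing_limit_integral Ci ni) => [v|n]; last exact: wP.
rewrite (_ : ereal_inf _ = ereal_inf (range (fun n => (C (f n v) v)%:E))).
  apply: ereal_nonincreasing_cvgn.
  by apply/nonincreasing_seqP => n; rewrite lee_fin.
apply/eqP; rewrite eq_le; apply/andP; split; apply: le_ereal_inf_tmp.
- move=> _ [n _ <-]; apply: ereal_inf_lbound => /=.
  have [m ->] : exists m, f n v = q m.
    elim: n => [|n [m IH]] /=; first by exists 0%N.
    by case: ifP => _; [exists n.+1|exists m].
  by exists m.
- move=> _ [n _ <-]; apply: (@le_trans _ _ (C (f n v) v)%:E).
    by apply: ereal_inf_lbound; exists n.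
  rewrite lee_fin; case: n => [|n] //=.
  by case: ltP => // /ltW.
Qed.

End step_integrals.

(** * Lagrange multipliers by separation in the plane *)

Section lagrange.
Context {R : realType} {d : measure_display} {V : measurableType d}.
Context (mu : probability V R).
Implicit Types (X : set R) (f Z : V -> R) (F : R -> R).

Lemma step_comp_integrable X F f : step X f ->
  mu.-integrable setT (EFin \o (fun v => F (f v))).
Proof. by move=> sf; exact: (step_integrable mu (step_comp F sf)). Qed.

Lemma Rintegral_prob_cst c : \int[mu]_v c = c :> R.
Proof. by rewrite Rintegral_cst // [X in fine X](probability_setT mu) mulr1. Qed.

Lemma Rintegral_combination t f g :
  mu.-integrable setT (EFin \o f) -> mu.-integrable setT (EFin \o g) ->
  \int[mu]_v (t * f v + (1 - t) * g v)
  = t * \int[mu]_v f v + (1 - t) * \int[mu]_v g v.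
Proof.
by move=> fi gi; rewrite RintegralD ?RintegralZl //; exact: integrableZl_EFin.
Qed.

Lemma convex_integral_combination X F f g t : segment_closed X ->
  convex_on X F -> 0 <= t <= 1 -> step X f -> step X g ->
  \int[mu]_v F (t * f v + (1 - t) * g v)
  <= t * \int[mu]_v F (f v) + (1 - t) * \int[mu]_v F (g v).
Proof.
move=> cX Fc t01 sf sg; have fi := step_comp_integrable F sf.
have gi := step_comp_integrable F sg.
rewrite -Rintegral_combination //; apply: le_Rintegral => //.
- exact: (step_comp_integrable F (step_conv cX t01 sf sg)).
- by apply: integrableD_EFin; exact: integrableZl_EFin.
- by move=> v _; apply: Fc => //; [case: sf|case: sg].
Qed.

(** Separation for the pairs (mass minus 1, cost minus [w]). Over mass 1 the second entry is
    non-negative by assumption; the constants [x] and [y] supply masses on both sides of 1. *)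
Lemma multiplier_for_mass X F Z w : segment_closed X -> convex_on X F ->
  mu.-integrable setT (EFin \o Z) ->
  (exists2 x, X x & x < 1) -> (exists2 x, X x & 1 < x) ->
  (forall f, step X f -> \int[mu]_v f v = 1 ->
    w <= \int[mu]_v (F (f v)) + \int[mu]_v (f v * Z v)) ->
  exists b, forall f, step X f ->
    w - b <= \int[mu]_v (F (f v) + f v * (Z v - b)).
Proof.
move=> cX Fc Zi [x Xx x1] [y Xy y1] wP.
pose S u r := exists2 f, step X f & u = \int[mu]_v f v - 1 /\
  r = \int[mu]_v (F (f v)) + \int[mu]_v (f v * Z v) - w.
have [|r [f sf [f1 ->]]||| l lP] := @slope_exists R S.
- move=> t u1 r1 u2 r2 t01 [f sf [-> ->]] [g sg [-> ->]].
  have sh := step_conv cX t01 sf sg; set h := fun v => _ in sh.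
  eexists; first by exists h => //; split; [|reflexivity];
    rewrite Rintegral_combination;
    [ring|exact: (step_integrable _ sf)|exact: (step_integrable _ sg)].
  have := convex_integral_combination cX Fc t01 sf sg.
  rewrite (_ : (fun v => h v * Z v) =
    (fun v => t * (f v * Z v) + (1 - t) * (g v * Z v))); last first.
    by apply/funext => v; rewrite /h; ring.
  rewrite Rintegral_combination; [|exact: stepM_integrable Zi sf|exact: stepM_integrable Zi sg].
  by lra.
- by rewrite subr_ge0; apply: wP => //; lra.
- exists (x - 1); eexists; split; last by lra.
  by exists (fun=> x); [exact: step_cst|rewrite Rintegral_prob_cst].
- exists (y - 1); eexists; split; last by lra.
  by exists (fun=> y); [exact: step_cst|rewrite Rintegral_prob_cst].
exists (- l) => f sf; have := lP _ _ (ex_intro2 _ _ f sf (conj erefl erefl)).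
rewrite (_ : (fun v => F (f v) + f v * (Z v - - l)) =
  (fun v => (F (f v) + f v * Z v) + l * f v)); last first.
  by apply/funext => v; ring.
have fi := step_integrable mu sf; have Ffi := step_comp_integrable F sf.
have fZi := stepM_integrable Zi sf.
rewrite RintegralD //; [|exact: integrableD_EFin|exact: integrableZl_EFin].
by rewrite RintegralZl // RintegralD //; lra.
Qed.

(** Separation for the pairs (divergence excess, cost minus [w]) over densities of mass 1. [S] is
    closed upwards in its first entry, which forces the slope to be non-negative. *)
Lemma multiplier_for_divergence X F Z w delta : segment_closed X ->
  convex_on X F -> mu.-integrable setT (EFin \o Z) ->
  X 1 -> F 1 = 0 -> 0 < delta ->
  (forall f, step X f -> \int[mu]_v f v = 1 -> \int[mu]_v F (f v) <= delta ->
    w <= \int[mu]_v (f v * Z v)) ->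
  exists2 l, 0 <= l & forall f, step X f -> \int[mu]_v f v = 1 ->
    w + l * delta <= \int[mu]_v (l * F (f v)) + \int[mu]_v (f v * Z v).
Proof.
move=> cX Fc Zi X1 F1 d0 wP.
pose S u r := exists f, [/\ step X f, \int[mu]_v f v = 1,
  \int[mu]_v F (f v) - delta <= u & r = \int[mu]_v (f v * Z v) - w].
(* The constant density 1 has divergence 0, so its excess is [- delta < 0]; upward closure then
   gives points on both sides of 0. *)
have S1 u : - delta <= u -> S u (\int[mu]_v (1 * Z v) - w).
  move=> du; exists (fun=> 1); split => //; first exact: step_cst.
    exact: Rintegral_prob_cst.
  by rewrite Rintegral_prob_cst F1; lra.
have [|r [f [sf f1 fd ->]]||| l lP] := @slope_exists R S.
- move=> t u1 r1 u2 r2 t01 [f [sf f1 fu ->]] [g [sg g1 gu ->]].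
  have sh := step_conv cX t01 sf sg; set h := fun v => _ in sh.
  eexists; first exists h; first split; [by []| | |reflexivity|].
  + rewrite Rintegral_combination ?f1 ?g1;
    [ring|exact: (step_integrable _ sf)|exact: (step_integrable _ sg)].
  + have := convex_integral_combination cX Fc t01 sf sg.
    by move=> /le_trans/(_ _) h'; rewrite lerBlDr; apply: h'; case/andP: t01 => *; nra.
  rewrite (_ : (fun v => h v * Z v) =
    (fun v => t * (f v * Z v) + (1 - t) * (g v * Z v))); last first.
    by apply/funext => v; rewrite /h; ring.
  rewrite Rintegral_combination; [|exact: stepM_integrable Zi sf|exact: stepM_integrable Zi sg].
  by lra.
- by rewrite subr_ge0; apply: wP => //; lra.
- exists (- delta); eexists; split; first exact: S1.
  by lra.
- exists delta; eexists; split; first by apply: S1; lra.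
  by lra.
exists l.
  rewrite leNgt; apply/negP => l0.
  set c := \int[mu]_v (1 * Z v) - w in S1.
  (* With [l < 0] this abscissa gives [l * u = - (|c| + 1)], which is below [- c], so the density 1
     placed over it violates [lP]. *)
  have u0 : 0 <= (`|c| + 1) / - l by apply: divr_ge0; [rewrite addr_ge0|lra].
  have : - delta <= (`|c| + 1) / - l by lra.
  move=> /S1 /lP; rewrite (_ : l * _ = - (`|c| + 1)); last by field; lra.
  by have := ler_norm c; lra.
move=> f sf f1.
have := lP _ _ (ex_intro _ f (And4 sf f1 (lexx _) erefl)).
have -> : \int[mu]_v (l * F (f v)) = l * \int[mu]_v F (f v).
  by apply: RintegralZl => //; exact: (step_comp_integrable F sf).
by lra.
Qed.

End lagrange.

(** * The dual integrand [Phi] *)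

Section Phi.
Context {R : realType}.
Implicit Types (phi : R -> R) (l b x z : R).

Lemma PhiE phi l b z : Phi phi l b z =
  ereal_inf [set (l * phi x + x * (z - b))%:E | x in [set x | 0 <= x]].
Proof.
rewrite /Phi /conjugate ereal_supEN oppeK image_comp; congr ereal_inf.
by apply: eq_imagel => x _ /=; congr EFin; ring.
Qed.

Lemma ge_Phi phi l b z x : 0 <= x ->
  (Phi phi l b z <= (l * phi x + x * (z - b))%:E)%E.
Proof. by move=> x0; rewrite PhiE; apply: ereal_inf_lbound; exists x. Qed.

Lemma le_Phi phi l b z (c : \bar R) :
  (forall x, 0 <= x -> (c <= (l * phi x + x * (z - b))%:E)%E) ->
  (c <= Phi phi l b z)%E.
Proof.
by move=> h; rewrite PhiE; apply: le_ereal_inf_tmp => _ [x x0 <-]; exact: h.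
Qed.

Lemma Phi_nondecreasing phi l b : {homo Phi phi l b : x y / x <= y >-> (x <= y)%E}.
Proof.
move=> z z' zz'; apply: le_Phi => x x0; apply: (le_trans (ge_Phi phi l b z x0)).
by rewrite lee_fin lerD2l ler_wpM2l // lerB.
Qed.

(** Superlevel sets of a monotone function are intervals. Measurability of [Phi] thus follows from
    its monotonicity in [z]. *)
Lemma nondecreasing_emeasurable (f : R -> \bar R) :
  {homo f : x y / x <= y >-> (x <= y)%E} -> measurable_fun setT f.
Proof.
move=> f_nd; apply: (measurability (@ErealGenCInfty.G R)) => [|_ [_ [r ->] <-]].
  exact: ErealGenCInfty.measurableE.
rewrite setTI; apply: is_interval_measurable.
move=> x y /=; rewrite !in_itv/= !andbT => rx _ z /andP[xz _].
by rewrite in_itv/= andbT (le_trans rx) // f_nd.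
Qed.

Lemma Phi_measurable phi l b : measurable_fun setT (Phi phi l b).
Proof. exact: nondecreasing_emeasurable (@Phi_nondecreasing phi l b). Qed.

(** A dense sequence in the half-line; the default 0 and the absolute value keep every term
    inside. *)
Definition nonneg_rat (n : nat) : R := `|ratr (odflt 0%R (unpickle n : option rat))|.

Lemma nonneg_rat_ge0 n : 0 <= nonneg_rat n. Proof. exact: normr_ge0. Qed.

Lemma nonneg_rat_between x y : 0 <= x -> x < y ->
  exists2 n, x < nonneg_rat n & nonneg_rat n < y.
Proof.
move=> x0 /rat_in_itvoo[q]; rewrite in_itv /= => /andP[xq qy].
exists (pickle q); rewrite /nonneg_rat pickleK /= ger0_norm //; exact: ltW (le_lt_trans x0 xq).
Qed.

(* Points slightly to the right of [x] are nearly as good as [x], because a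
   convex function lies below its chord on [x, x + 1]; no continuity of [phi]
   (which may fail at 0) is needed. *)
Lemma Phi_inf_rat phi l b z : convex_on [set x | 0 <= x] phi -> 0 <= l ->
  Phi phi l b z = ereal_inf (range (fun n =>
    (l * phi (nonneg_rat n) + nonneg_rat n * (z - b))%:E)).
Proof.
move=> pc l0; apply/eqP; rewrite eq_le; apply/andP; split.
  by apply: le_ereal_inf_tmp => _ [n _ <-]; exact: ge_Phi (nonneg_rat_ge0 n).
apply: le_Phi => x x0; apply/lee_addgt0Pr => e e0.
(* [D] is the slope of the chord over [x, x + 1] of the function being minimised; [t0] keeps the
   rise [t * D] below [e]. *)
pose D := l * (phi (x + 1) - phi x) + (z - b).
pose t0 := Num.min 1 (e / (`|D| + 1)).
have t00 : 0 < t0 by rewrite lt_min ltr01 divr_gt0 // ltr_wpDl.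
have xt0 : x < x + t0 by rewrite ltrDl.
have [n xn nt] := nonneg_rat_between x0 xt0.
apply: (@le_trans _ _ (l * phi (nonneg_rat n) + nonneg_rat n * (z - b))%:E).
  by apply: ereal_inf_lbound; exists n.
rewrite -EFinD lee_fin.
set q := nonneg_rat n in xn nt *; pose t := q - x.
have tt0 : t < t0 by rewrite /t; lra.
have t0' : 0 < t by rewrite /t; lra.
have [t1 te] : t < 1 /\ t < e / (`|D| + 1).
  by move: tt0; rewrite lt_min => /andP[].
have t01 : 0 <= t <= 1 by rewrite !ltW.
have x1 : 0 <= x + 1 by lra.
have := pc t (x + 1) x t01 x1 x0.
have -> : t * (x + 1) + (1 - t) * x = q by rewrite /t; ring.
move=> /(ler_wpM2l l0) pq.
have tD : t * D <= e.
  move: te; rewrite ltr_pdivlMr ?ltr_wpDl // => te.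
  by have := ler_norm D; nra.
by rewrite /D in tD; rewrite (_ : q = x + t) in pq *; [nra|rewrite /t; ring].
Qed.

End Phi.

(** * Densities and Radon-Nikodym derivatives *)

Section density.
Context {R : realType} {d : measure_display} {V : measurableType d}.
Context (mu : probability V R).
Implicit Types (f Z : V -> R) (phi : R -> R).

Lemma density_probability f : (forall v, 0 <= f v) ->
  mu.-integrable setT (EFin \o f) -> \int[mu]_v f v = 1 ->
  exists nu : probability V R,
    forall A, measurable A -> nu A = (\int[mu]_(v in A) (f v)%:E)%E.
Proof.
move=> f0 fi f1; pose m A := (\int[mu]_(v in A) (f v)%:E)%E.
have m0 : m set0 = 0%E by rewrite /m integral_set0.
have m_ge0 A : (0 <= m A)%E by apply: integral_ge0 => v _; rewrite lee_fin.
have m_sigma : semi_sigma_additive m.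
  move=> /= A mA tA mUA; rewrite /m integral_bigcup //; last first.
    exact: (integrableS _ _ (subsetT _)).
  apply: is_cvg_ereal_nneg_natsum_cond => n _ _.
  by apply: integral_ge0 => v _; rewrite lee_fin.
pose nu0 : {measure set V -> \bar R} :=
  HB.pack m (isMeasure.Build _ _ _ m m0 m_ge0 m_sigma).
have nu1 : nu0 setT = 1%E by rewrite /= /m -EFin_Rintegral // f1.
pose nu : probability V R :=
  HB.pack (Measure.sort nu0) (Measure_isProbability.Build _ _ _ nu0 nu1).
by exists nu.
Qed.

Lemma density_dominates (nu : probability V R) f :
  mu.-integrable setT (EFin \o f) -> 
  (forall A, measurable A -> nu A = (\int[mu]_(v in A) (f v)%:E)%E) ->
  nu `<< mu.
Proof.
move=> fi nuE; apply/null_content_dominatesP => A mA muA.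
rewrite nuE //; apply: null_set_integral => //.
by apply: measurable_funTS; exact: measurable_int fi.
Qed.

(** The divergence is defined through one fixed version of the derivative, so a prescribed density
    must be identified with it almost everywhere. *)
Lemma density_Radon_Nikodym (nu : probability V R) f :
  mu.-integrable setT (EFin \o f) ->
  (forall A, measurable A -> nu A = (\int[mu]_(v in A) (f v)%:E)%E) ->
  ae_eq mu setT (Radon_Nikodym_SigmaFinite.f nu mu) (EFin \o f).
Proof.
move=> fi nuE; have numu := density_dominates fi nuE.
apply: integral_ae_eq => //.
- exact: Radon_Nikodym_SigmaFinite.f_integrable.
- exact: measurable_int fi.
- by move=> A _ mA; rewrite -Radon_Nikodym_SigmaFinite.f_integral //; exact: nuE.
Qed.

Definition rn_density (nu : probability V R) v : R :=
  fine (Radon_Nikodym_SigmaFinite.f nu mu v).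

Section rn_density.
Context (nu : probability V R).
Hypothesis numu : nu `<< mu.

Lemma rn_densityE v : (rn_density nu v)%:E = Radon_Nikodym_SigmaFinite.f nu mu v.
Proof. by rewrite fineK // Radon_Nikodym_SigmaFinite.f_fin_num. Qed.

Lemma rn_density_ge0 v : 0 <= rn_density nu v.
Proof. by rewrite fine_ge0 // Radon_Nikodym_SigmaFinite.f_ge0. Qed.

Lemma rn_density_integrable : mu.-integrable setT (EFin \o rn_density nu).
Proof.
apply: eq_integrable (Radon_Nikodym_SigmaFinite.f_integrable numu) => // v _.
by rewrite /= rn_densityE.
Qed.

Lemma rn_density_integral1 : \int[mu]_v rn_density nu v = 1.
Proof.
apply: EFin_inj; rewrite EFin_Rintegral; last exact: rn_density_integrable.
under eq_integral do rewrite rn_densityE.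
rewrite -Radon_Nikodym_SigmaFinite.f_integral //; exact: probability_setT.
Qed.

(** The identity [part] for non-negative functions is applied to the absolute value and to the
    positive and negative parts of [Z]; these commute with the non-negative density. *)
Lemma rn_density_change_of_variables Z : nu.-integrable setT (EFin \o Z) ->
  mu.-integrable setT (EFin \o (fun v => rn_density nu v * Z v)) /\
  (\int[nu]_v (Z v)%:E = \int[mu]_v (rn_density nu v * Z v)%:E)%E.
Proof.
move=> Zi; have mZ := measurable_int _ Zi.
have mr := measurable_int _ rn_density_integrable.
have part g : (forall v, 0 <= g v)%E -> measurable_fun setT g ->
    (\int[mu]_v ((rn_density nu v)%:E * g v) = \int[nu]_v g v)%E.
  move=> g0 mg; rewrite -(Radon_Nikodym_SigmaFinite.change_of_variables numu) //.
  by apply: eq_integral => v _; rewrite rn_densityE muleC.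
split.
  apply/integrableP; split.
    by apply/measurable_EFinP; apply: measurable_funM; exact/measurable_EFinP.
  have /integrableP[_] := Zi; rewrite -part //; last exact: measurableT_comp.
  apply: le_lt_trans; rewrite le_eqVlt; apply/orP; left; apply/eqP.
  by apply: eq_integral => v _ /=; rewrite normrM (ger0_norm (rn_density_ge0 v)).
rewrite integralE [RHS]integralE; congr (_ - _)%E.
  rewrite -part //; last exact: measurable_funepos.
  apply: eq_integral => v _; rewrite !funeposE /= -!EFin_max -EFinM.
  by rewrite maxr_pMr ?mulr0 ?rn_density_ge0.
rewrite -part //; last exact: measurable_funeneg.
apply: eq_integral => v _; rewrite !funenegE /= -!EFin_max -EFinM.
by rewrite maxr_pMr ?mulr0 ?mulrN ?rn_density_ge0.
Qed.

End rn_density.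
End density.

(** * Membership in the divergence ball, and weak duality *)

Section divergence_ball.
Context {R : realType} {d : measure_display} {V : measurableType d}.
Context (mu : probability V R) (phi : R -> R) (delta : R) (Z : V -> R).
Hypothesis phi_convex : convex_on [set x | 0 <= x] phi.
Hypothesis phi1 : phi 1 = 0.
Hypothesis Z_ball : forall nu, divergence_ball phi mu delta nu ->
  nu.-integrable setT (EFin \o Z).

Lemma phi_divergenceE (nu : probability V R) : nu `<< mu ->
  phi_divergence phi nu mu = (\int[mu]_v (phi (rn_density mu nu v))%:E)%E.
Proof. by move=> numu; rewrite /phi_divergence asboolT. Qed.

(** Makes finitely valued densities competitors in the primal problem. The divergence is computed
    from [rn_density], which equals [f] only almost everywhere. *)
Lemma step_density_in_ball f : mu.-integrable setT (EFin \o Z) ->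
  step [set x | 0 <= x] f -> \int[mu]_v f v = 1 ->
  \int[mu]_v phi (f v) <= delta ->
  exists2 nu, divergence_ball phi mu delta nu
    & (\int[nu]_v (Z v)%:E = (\int[mu]_v (f v * Z v))%:E)%E.
Proof.
move=> Zi sf f1 fd; have fi := step_integrable mu sf.
have [_ _ f0] := sf.
have [nu nuE] := density_probability f0 fi f1.
have numu := density_dominates fi nuE.
have rf : ae_eq mu setT (EFin \o rn_density mu nu) (EFin \o f).
  apply: filterS (density_Radon_Nikodym fi nuE) => v h _.
  by rewrite /= (rn_densityE numu) h.
have mr : measurable_fun setT (rn_density mu nu).
  by apply/measurable_EFinP; exact: measurable_int (rn_density_integrable numu).
have phifi := step_comp_integrable mu phi sf.
have nu_ball : divergence_ball phi mu delta nu.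
  rewrite /divergence_ball /= phi_divergenceE //.
  have -> : (\int[mu]_v (phi (rn_density mu nu v))%:E = \int[mu]_v (phi (f v))%:E)%E.
    apply: ae_eq_integral => //.
    - apply/measurable_EFinP; apply: convex_measurable_comp => //.
      exact: rn_density_ge0.
    - exact: measurable_int phifi.
    - by apply: filterS rf => v h vT /=; case: (h vT) => ->.
  by rewrite -EFin_Rintegral // lee_fin.
exists nu => //.
have [rZi ->] := rn_density_change_of_variables numu (Z_ball nu_ball).
rewrite EFin_Rintegral; last exact: stepM_integrable Zi sf.
apply: ae_eq_integral => //.
- exact: measurable_int rZi.
- exact: measurable_int (stepM_integrable Zi sf).
- by apply: filterS rf => v h vT /=; case: (h vT) => ->.
Qed.

(** Membership only bounds an extended integral from above. An affine minorant of [phi] makes the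
    negative part integrable, and the bound [delta] then makes the positive part integrable. *)
Lemma ball_divergence_integrable nu : divergence_ball phi mu delta nu ->
  [/\ nu `<< mu, mu.-integrable setT (EFin \o (fun v => phi (rn_density mu nu v)))
    & \int[mu]_v phi (rn_density mu nu v) <= delta].
Proof.
move=> nuB; have numu : nu `<< mu.
  apply: contrapT => h; move: nuB.
  by rewrite /divergence_ball /= /phi_divergence asboolF // leye_eq.
move: nuB; rewrite /divergence_ball /= phi_divergenceE // => nud.
have [s sP] := convex_minorant phi_convex phi1.
have r0 := rn_density_ge0 numu; have ri := rn_density_integrable numu.
have mr : measurable_fun setT (rn_density mu nu).
  by apply/measurable_EFinP; exact: measurable_int ri.
have mphi : measurable_fun setT (EFin \o (fun v => phi (rn_density mu nu v))).
  by apply/measurable_EFinP; exact: convex_measurable_comp.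
set g := EFin \o _ in mphi *.
have si : mu.-integrable setT (EFin \o (fun v => s * (rn_density mu nu v - 1))).
  apply: integrableZl_EFin; apply: integrableB_EFin => //.
  exact: finite_measure_integrable_cst.
have gN : mu.-integrable setT (g^\-)%E.
  apply: le_integrable (integrable_abse si) => //.
    exact: measurable_funeneg.
  move=> v _; rewrite gee0_abs // ?funenegE ?le_max ?lexx ?orbT //.
  rewrite ge_max abse_ge0 andbT /= lee_fin.
  have := ler_norm (- (s * (rn_density mu nu v - 1))); rewrite normrN.
  by rewrite normr_id; have := sP _ (r0 v); lra.
have gP : (\int[mu]_v g^\+ v < +oo)%E.
  move: nud; rewrite integralE leeBlDr ?integrable_fin_num // => /le_lt_trans; apply.
  by rewrite -(fineK (integrable_fin_num measurableT gN)) -EFinD ltry.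
have gi : mu.-integrable setT g.
  rewrite (funeposneg g); apply: integrableB => //.
  apply/integrableP; split; first exact: measurable_funepos.
  by under eq_integral do rewrite gee0_abs //.
by split => //; rewrite -lee_fin EFin_Rintegral.
Qed.

Lemma weak_duality nu l b : mu.-integrable setT (EFin \o Z) ->
  0 <= l -> divergence_ball phi mu delta nu ->
  ((b - l * delta)%:E + \int[mu]_v Phi phi l b (Z v) <= \int[nu]_v (Z v)%:E)%E.
Proof.
move=> Zi l0 nuB; have [numu phii phid] := ball_divergence_integrable nuB.
have r0 := rn_density_ge0 numu; have ri := rn_density_integrable numu.
have [rZi ->] := rn_density_change_of_variables numu (Z_ball nuB).
set r := rn_density mu nu in r0 ri rZi phii phid *.
have mZ : measurable_fun setT Z by apply/measurable_EFinP; exact: measurable_int Zi.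
(* Mass 1 and divergence at most [delta] bound the integral of [u] by [l * delta - b] plus the
   integral of [Z] under [nu]. *)
pose u v := l * phi (r v) + (r v * Z v - b * r v).
have li := integrableZl_EFin l phii; have bi := integrableZl_EFin b ri.
have ui : mu.-integrable setT (EFin \o u).
  by apply: integrableD_EFin => //; exact: integrableB_EFin.
have Phiu : (\int[mu]_v Phi phi l b (Z v) <= \int[mu]_v (u v)%:E)%E.
  apply: measurable_le_integral.
  - by apply: measurableT_comp => //; exact: Phi_measurable.
  - exact: measurable_int ui.
  - move=> v; apply: (le_trans (ge_Phi phi l b (Z v) (r0 v))).
    by rewrite lee_fin /u; lra.
apply: (le_trans (leeD2l _ Phiu)).
rewrite -!EFin_Rintegral // -EFinD lee_fin.
rewrite RintegralD ?RintegralB ?RintegralZl //; last exact: integrableB_EFin.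
by rewrite rn_density_integral1 //; nra.
Qed.

End divergence_ball.

(** * Strong duality at positive radius *)

Section strong_duality.
Context {R : realType} {d : measure_display} {V : measurableType d}.
Context (mu : probability V R).
Implicit Types (f Z : V -> R) (phi psi : R -> R).

Lemma strong_duality_pos phi Z w delta : convex_on [set x | 0 <= x] phi ->
  phi 1 = 0 -> mu.-integrable setT (EFin \o Z) -> 0 < delta ->
  (forall f, step [set x | 0 <= x] f -> \int[mu]_v f v = 1 ->
    \int[mu]_v phi (f v) <= delta -> w <= \int[mu]_v (f v * Z v)) ->
  exists l b, 0 <= l /\
    (w%:E <= (b - l * delta)%:E + \int[mu]_v Phi phi l b (Z v))%E.
Proof.
move=> pc p1 Zi d0 wP; have cX := @segment_closed_ge0 R.
have [l l0 lP] := multiplier_for_divergence cX pc Zi ler01 p1 d0 wP.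
have lc : convex_on [set x | 0 <= x] (fun x => l * phi x).
  by move=> t x y t01 x0 y0; have := ler_wpM2l l0 (pc t x y t01 x0 y0); lra.
(* [lP] bounds the penalised cost below by [w + l * delta], which takes the role of [w]; the
   constants 0 and 2 have masses on both sides of 1. *)
have [||b bP] := multiplier_for_mass cX lc Zi _ _ lP.
- by exists 0 => //=.
- by exists 2 => /=; [exact: ler0n|lra].
exists l, b; split => //.
have Zbi : mu.-integrable setT (EFin \o (fun v => Z v - b)).
  by apply: integrableB_EFin => //; exact: finite_measure_integrable_cst.
have := step_interchange (F := fun x => l * phi x) (@nonneg_rat_ge0 R) Zbi bP.
under eq_integral do rewrite -Phi_inf_rat //.
move=> /(leeD2l (b - l * delta)%:E); apply: le_trans.
by rewrite -EFinD lee_fin; lra.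
Qed.

Lemma integrable_between (f g h : V -> \bar R) : measurable_fun setT g ->
  mu.-integrable setT f -> mu.-integrable setT h ->
  (forall v, (f v <= g v)%E) -> (forall v, (g v <= h v)%E) ->
  mu.-integrable setT g.
Proof.
move=> mg fi hi fg gh.
apply: (le_integrable measurableT mg _
  (integrableD measurableT (integrable_abse fi) (integrable_abse hi))).
move=> v _ /=; rewrite [leRHS]gee0_abs ?adde_ge0 //.
have [g0|/ltW g0] := leP 0%E (g v).
  by rewrite gee0_abs // (le_trans (gh v)) // (le_trans (lee_abs _)) // leeDr.
rewrite lee0_abs //; apply: (@le_trans _ _ `|f v|%E); last by rewrite leeDl.
apply: (@le_trans _ _ (- f v)%E); first by rewrite leeN2.
by rewrite -abseN lee_abs.
Qed.

Lemma integrable_bounded_above (g h : V -> \bar R) w : measurable_fun setT g ->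
  mu.-integrable setT h -> (forall v, (g v <= h v)%E) ->
  (w%:E <= \int[mu]_v g v)%E -> mu.-integrable setT g.
Proof.
move=> mg hi gh wg.
have gP : mu.-integrable setT (g^\+)%E.
  apply: (le_integrable measurableT _ _ (integrable_funepos measurableT hi)).
    exact: measurable_funepos.
  move=> v _; rewrite !gee0_abs //.
  by apply: (@funepos_le _ _ setT); [move=> *; exact: gh|exact: mem_set].
have gPf := integrable_fin_num measurableT gP.
have gN : (\int[mu]_v g^\- v < +oo)%E.
  move: wg; rewrite integralE -(fineK gPf).
  by case: (\int[mu]_v _)%E => [r||] //; rewrite ?ltry ?ltNyr //=.
rewrite (funeposneg g); apply: integrableB => //.
apply/integrableP; split; first exact: measurable_funeneg.
by under eq_integral do rewrite gee0_abs //.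
Qed.

(** * Strong duality at radius zero *)

Section zero_radius.
Context (psi : R -> R) (Z : V -> R).
Hypothesis psi_convex : convex_on [set x | 0 <= x] psi.
Hypothesis psi_ge0 : forall x, 0 <= x -> 0 <= psi x.
Hypothesis psi1 : psi 1 = 0.
Hypothesis Zi : mu.-integrable setT (EFin \o Z).

Let J := [set x | 0 <= x /\ psi x = 0].

(** [z] is a convex combination of [x] and the minimiser 1. The case [x = 1] is separate because the
    weight divides by [x - 1]. *)
Lemma psi_away x z : 0 <= x -> (1 <= z <= x) || (x <= z <= 1) -> psi z <= psi x.
Proof.
move=> x0 zx; have [x1|x1] := eqVneq x 1.
  by have -> : z = x by move: zx; rewrite x1 => /orP[] /andP[]; lra.
pose t := (z - 1) / (x - 1).
have t01 : 0 <= t <= 1.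
  move: x1; rewrite neq_lt => /orP[] x1; case/orP: zx => /andP[] z1 z2.
  - lra.
  - by rewrite /t -mulrNN -invrN divr_ge0 ?ler_pdivrMr //=; lra.
  - by apply/andP; split; [apply: divr_ge0|rewrite ler_pdivrMr]; lra.
  - lra.
have := psi_convex t01 x0 ler01.
have -> : t * x + (1 - t) * 1 = z by rewrite /t; field; lra.
have := psi_ge0 x0; rewrite psi1; case/andP: t01; nra.
Qed.

Lemma J_between x z : J x -> (1 <= z <= x) || (x <= z <= 1) -> J z.
Proof.
move=> [x0 px] zx; have z0 : 0 <= z by case/orP: zx => /andP[]; lra.
split => //; have := psi_away x0 zx; have := psi_ge0 z0; lra.
Qed.

Lemma J_convex : segment_closed J.
Proof.
move=> t x y t01 [x0 px] [y0 py]; have z0 := segment_closed_ge0 t01 x0 y0.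
split => //; have := psi_convex t01 x0 y0; have := psi_ge0 z0.
by rewrite px py; lra.
Qed.

Lemma J1 : J 1. Proof. by split. Qed.

Definition J_rat n : R := if `[< J (nonneg_rat n) >] then nonneg_rat n else 1.

Lemma J_ratP n : J (J_rat n).
Proof. by rewrite /J_rat; case: asboolP => // _; exact: J1. Qed.

Lemma J_rat_between x y : 0 <= x -> x < y ->
  (forall z, x < z < y -> J z) -> exists2 n, x < J_rat n & J_rat n < y.
Proof.
move=> x0 xy Jxy; have [n xn ny] := nonneg_rat_between x0 xy.
by exists n; rewrite /J_rat asboolT //; apply: Jxy; rewrite xn.
Qed.

Lemma J_rat1 : exists n, J_rat n = 1.
Proof.
exists (pickle (1 : rat)).
rewrite /J_rat /nonneg_rat pickleK /= rmorph1 normr1; by case: asboolP.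
Qed.

Lemma Phi_nondecreasing_multiplier l l' b z : l <= l' ->
  (Phi psi l b z <= Phi psi l' b z)%E.
Proof.
move=> ll; apply: le_Phi => x x0; apply: le_trans (ge_Phi _ _ _ _ x0) _.
by rewrite lee_fin lerD2r ler_wpM2r // psi_ge0.
Qed.

(* If the supremum were below some [c] smaller than all [q * (z - b)] with [q]
   in [J], near-minimisers [x] for large multipliers would have [psi x] small
   and lie beyond [c / (z - b)]; but that point is outside [J], so [psi] is
   bounded away from 0 there. *)
Lemma Phi_limit l b z : 0 <= l -> Phi psi l b z != -oo%E ->
  (ereal_inf (range (fun n => (0 + J_rat n * (z - b))%:E))
   <= ereal_sup (range (fun n : nat => Phi psi (l + n%:R) b z)))%E.
Proof.
move=> l0 Phi0; set y := z - b; set I := ereal_inf _; set S := ereal_sup _.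
rewrite leNgt; apply/negP => SI.
have IJ x : (exists n, J_rat n = x) -> (I <= (x * y)%:E)%E.
  by move=> [n <-]; apply: ereal_inf_lbound; exists n => //; rewrite add0r.
have Iy : (I <= y%:E)%E by rewrite -[y]mul1r; apply: IJ; exact: J_rat1.
have SPhi n : (Phi psi (l + n%:R) b z <= S)%E.
  by apply: ereal_sup_ubound; exists n.
have SPhi0 : (Phi psi l b z <= S)%E by have := SPhi 0%N; rewrite addr0.
have PhiS : Phi psi l b z \is a fin_num.
  rewrite fin_numE Phi0 /=; apply/negP => /eqP h.
  by have := le_lt_trans SPhi0 (lt_le_trans SI Iy); rewrite h.
have Sf : S \is a fin_num.
  rewrite fin_numE -ltNye -ltey (lt_le_trans SI (leey _)) andbT.
  by apply: lt_le_trans SPhi0; rewrite ltNye.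
have If : I \is a fin_num.
  by rewrite fin_numE -ltNye -ltey (le_lt_trans Iy (ltry _)) (le_lt_trans (leNye _) SI).
set i := fine I; have iE : I = i%:E by rewrite fineK.
set s := fine S; have sE : S = s%:E by rewrite fineK.
set g := fine (Phi psi l b z); have gE : Phi psi l b z = g%:E by rewrite fineK.
rewrite iE sE lte_fin in SI; pose c := (s + i) / 2.
have [sc ci] : s < c /\ c < i by rewrite /c; lra.
have iy : i <= y by rewrite -lee_fin -iE.
(* Take a value below [c] at multiplier [l + n] and subtract the value at [l] of the same [x], which
   is at least [g]. *)
have xP n : exists x, [/\ 0 <= x, n%:R * psi x <= c - g & x * y < c].
  have : (Phi psi (l + n%:R) b z < c%:E)%E.
    by apply: (le_lt_trans (SPhi n)); rewrite sE lte_fin.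
  rewrite PhiE => /ereal_inf_lt[_ [x /= x0 <-]]; rewrite lte_fin -/y => xc.
  have := ge_Phi psi l b z x0; rewrite gE lee_fin -/y => gx.
  exists x; split => //; first by lra.
  by have := mulr_ge0 (addr_ge0 l0 (ler0n R n)) (psi_ge0 x0); lra.
have [y0|y0] := eqVneq y 0.
  by have [x [_ _]] := xP 0%N; rewrite y0 mulr0 => c0; move: iy; rewrite y0; lra.
pose xs := c / y.
have xsy : xs * y = c by rewrite /xs mulfVK.
(* As [1 * y] is at least [i > c] and [x * y < c], the crossing point [xs] lies between 1 and
   [x]. *)
have far x : 0 <= x -> x * y < c -> (1 <= xs <= x) || (x <= xs <= 1).
  move=> x0 xyc; move: y0; rewrite neq_lt => /orP[] y0; apply/orP; [left|right];
    apply/andP; split; nra.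
have xs0 : 0 <= xs.
  by have [x [x0 _ xc]] := xP 0%N; case/orP: (far x x0 xc) => /andP[]; lra.
have psi_xs : 0 < psi xs.
  rewrite lt_neqAle psi_ge0 // andbT eq_sym; apply/negP => /eqP pxs.
  have Jxs : J xs by split.
  (* If [psi xs] vanished, [J] would contain all points between 1 and [xs]; a term of [J_rat]
     strictly between [i / y] and [xs] would give a value below the infimum [i]. *)
  pose iy' := i / y; have iy'y : iy' * y = i by rewrite /iy' mulfVK.
  move: y0; rewrite neq_lt => /orP[] y0.
    have i1 : 1 <= iy' by nra.
    have iy0 : 0 <= iy' by lra.
    have iyxs : iy' < xs by nra.
    have [|n n1 n2] := J_rat_between iy0 iyxs.
      move=> q /andP[q1 q2]; apply: (J_between Jxs); apply/orP; left.
      by apply/andP; split; lra.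
    have := IJ (J_rat n) (ex_intro _ n erefl); rewrite iE lee_fin; nra.
  have i1 : iy' <= 1 by nra.
  have iyxs : xs < iy' by nra.
  have [|n n1 n2] := J_rat_between xs0 iyxs.
    move=> q /andP[q1 q2]; apply: (J_between Jxs); apply/orP; right.
    by apply/andP; split; lra.
  have := IJ (J_rat n) (ex_intro _ n erefl); rewrite iE lee_fin; nra.
have bound n : n%:R * psi xs <= c - g.
  have [x [x0 nx xc]] := xP n; apply: le_trans nx.
  by rewrite ler_wpM2l //; apply: psi_away => //; exact: far.
pose m := (Num.truncn ((c - g) / psi xs)).+1.
have := bound m; rewrite -ler_pdivlMr // leNgt => /negP; apply.
by rewrite truncnS_gt.
Qed.

Let mZ : measurable_fun setT Z.
Proof. by apply/measurable_EFinP; exact: measurable_int Zi. Qed.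

Let ZBi b : mu.-integrable setT (EFin \o (fun v => Z v - b)).
Proof. by apply: integrableB_EFin => //; exact: finite_measure_integrable_cst. Qed.

Lemma Phi_comp_measurable l b : measurable_fun setT (fun v => Phi psi l b (Z v)).
Proof. by apply: measurableT_comp => //; exact: Phi_measurable. Qed.

Lemma Phi_le_sub l b z : (Phi psi l b z <= (z - b)%:E)%E.
Proof. by have := ge_Phi psi l b z ler01; rewrite psi1 mulr0 add0r mul1r. Qed.

Lemma Phi_integrable_above (f : V -> \bar R) l b : mu.-integrable setT f ->
  (forall v, (f v <= Phi psi l b (Z v))%E) ->
  mu.-integrable setT (fun v => Phi psi l b (Z v)).
Proof.
move=> fi fP; apply: integrable_between fi (ZBi b) fP _.
  exact: Phi_comp_measurable.
by move=> v; exact: Phi_le_sub.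
Qed.

Lemma Phi_integrable_multiplier l l' b : l <= l' ->
  mu.-integrable setT (fun v => Phi psi l b (Z v)) ->
  mu.-integrable setT (fun v => Phi psi l' b (Z v)).
Proof.
by move=> ll Pi; apply: (Phi_integrable_above Pi) => v; exact: Phi_nondecreasing_multiplier.
Qed.

(** Dominated convergence along the multipliers [l + n]: the integrands lie between [Phi] at [l] and
    [Z - b]. By [Phi_limit] their limit is almost everywhere at least the infimum over [J], whose
    integral [step_interchange] bounds below. *)
Lemma Phi_integral_limit l b w (M : \bar R) : 0 <= l ->
  mu.-integrable setT (fun v => Phi psi l b (Z v)) ->
  (forall f, step J f -> w <= \int[mu]_v (f v * (Z v - b))) ->
  (forall l', l <= l' -> (\int[mu]_v Phi psi l' b (Z v) <= M)%E) ->
  (w%:E <= M)%E.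
Proof.
move=> l0 Pi wP MP.
pose P n v := Phi psi (l + n%:R) b (Z v).
have P0 v : P 0%N v = Phi psi l b (Z v) by rewrite /P addr0.
have ndP v : nondecreasing_seq (P ^~ v).
  by move=> n m nm; apply: Phi_nondecreasing_multiplier; rewrite lerD2l ler_nat.
pose S v := ereal_sup (range (P ^~ v)).
have PS v : P ^~ v @ \oo --> S v by exact: ereal_nondecreasing_cvgn.
have mP n : measurable_fun setT (P n) by exact: Phi_comp_measurable.
have mS : measurable_fun setT S by apply: (emeasurable_fun_cvg P) => // v _; exact: PS.
have gi := integrableD measurableT (integrable_abse Pi) (integrable_abse (ZBi b)).
have PB v n : (`|P n v| <= `|Phi psi l b (Z v)| + `|(Z v - b)%:E|)%E.
  have P0n : (P 0%N v <= P n v)%E by exact: ndP.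
  rewrite P0 in P0n; have [g0|/ltW g0] := leP 0%E (P n v).
    rewrite gee0_abs //; apply: (le_trans (Phi_le_sub _ _ _)).
    by apply: (le_trans (lee_abs _)); rewrite leeDr.
  rewrite lee0_abs //; apply: (@le_trans _ _ `|Phi psi l b (Z v)|%E); last by rewrite leeDl.
  apply: (@le_trans _ _ (- Phi psi l b (Z v))%E); first by rewrite leeN2.
  by rewrite -abseN lee_abs.
have [_ _ cvP] := @dominated_convergence _ _ _ mu setT measurableT P S _ mP mS
  (aeW _ (fun v _ => PS v)) gi (aeW _ (fun v n _ => PB v n)).
have SM : (\int[mu]_v S v <= M)%E.
  rewrite -(cvg_lim _ cvP) //; apply: lime_le; first by apply/cvg_ex; eexists; exact: cvP.
  by apply: nearW => n; apply: MP; rewrite lerDl.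
pose I v := ereal_inf (range (fun n => (0 + J_rat n * (Z v - b))%:E)).
have wI : (w%:E <= \int[mu]_v I v)%E.
  apply: (step_interchange (F := fun=> 0) J_ratP (ZBi b)) => f sf.
  by under eq_Rintegral do rewrite add0r; exact: wP.
have mI : measurable_fun setT I.
  suff mi : measurable_fun setT
      (fun z : R => ereal_inf (range (fun n => (0 + J_rat n * (z - b))%:E))).
    exact: (measurableT_comp mi mZ).
  apply: nondecreasing_emeasurable => x y xy; apply: le_ereal_inf_tmp => _ [n _ <-].
  apply: (@le_trans _ _ (0 + J_rat n * (x - b))%:E).
    by apply: ereal_inf_lbound; exists n.
  rewrite lee_fin !add0r ler_wpM2l ?lerB //.
  by have [] := J_ratP n.
apply: (le_trans wI); apply: le_trans SM.
(* [I <= S] is known only where [Phi] at [l] is finite, that is almost everywhere; the minimum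
   equals [I] there and lies below [S] everywhere. *)
have -> : (\int[mu]_v I v = \int[mu]_v mine (I v) (S v))%E.
  apply: ae_eq_integral => //; first exact: measurable_mine.
  apply: filterS (integrable_ae measurableT Pi) => v Pv _.
  by rewrite min_l //; apply: Phi_limit => //; move: (Pv Logic.I); rewrite fin_numE => /andP[].
apply: measurable_le_integral => // [|v]; first exact: measurable_mine.
by rewrite ge_min lexx orbT.
Qed.

(** Reduces radius zero to finding one [b] with both a mass multiplier bound and an integrable
    [Phi]. *)
Lemma dual_bound l b w (M : \bar R) : 0 <= l ->
  mu.-integrable setT (fun v => Phi psi l b (Z v)) ->
  (forall f, step J f -> w - b <= \int[mu]_v (f v * (Z v - b))) ->
  (forall l b, 0 <= l -> mu.-integrable setT (fun v => Phi psi l b (Z v)) ->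
    (b%:E + \int[mu]_v Phi psi l b (Z v) <= M)%E) ->
  (w%:E <= M)%E.
Proof.
move=> l0 Pi wP MP; have := Phi_integral_limit (M := (M - b%:E)%E) l0 Pi wP.
rewrite EFinB leeD2rE //; apply => l' ll'.
by rewrite leeBrDl // MP ?(le_trans l0) //; exact: Phi_integrable_multiplier Pi.
Qed.

(** By convexity [psi y >= c * (y - x)] on the half-line. Raising the multiplier by [k] therefore
    absorbs the change [(b' - b) * y], at the constant cost [k * c * x]. *)
Lemma Phi_integrable_growth x l b b' : 1 < x -> 0 < psi x -> 0 <= l ->
  mu.-integrable setT (fun v => Phi psi l b (Z v)) ->
  exists2 l', 0 <= l' & mu.-integrable setT (fun v => Phi psi l' b' (Z v)).
Proof.
move=> x1 px l0 Pi; pose c := psi x / (x - 1).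
have c0 : 0 < c by rewrite divr_gt0 // subr_gt0.
have cP y : 0 <= y -> c * (y - x) <= psi y.
  move=> y0; have [yx|xy] := leP y x.
    by apply: le_trans (psi_ge0 y0); nra.
  pose t := (x - 1) / (y - 1).
  have t01 : 0 <= t <= 1.
    by apply/andP; split; [apply: divr_ge0|rewrite ler_pdivrMr]; lra.
  have := psi_convex t01 y0 ler01.
  have -> : t * y + (1 - t) * 1 = x by rewrite /t; field; lra.
  rewrite psi1 mulr0 addr0 => h.
  have : c * (y - 1) <= psi y.
    rewrite /c mulrAC ler_pdivrMr ?subr_gt0 //.
    have -> : psi y * (x - 1) = (t * psi y) * (y - 1) by rewrite /t; field; lra.
    by rewrite ler_wpM2r //; lra.
  by nra.
pose k := Num.max 0 ((b' - b) / c).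
have k0 : 0 <= k by rewrite le_max lexx.
have kc : b' - b <= k * c by rewrite -ler_pdivrMr // le_max lexx orbT.
exists (l + k); first exact: addr_ge0.
have ci := finite_measure_integrable_cst mu (- (k * c * x)) measurableT.
apply: (Phi_integrable_above (integrableD measurableT Pi ci)) => v.
apply: le_Phi => y y0; apply: (le_trans (leeD2r _ (ge_Phi psi l b (Z v) y0))).
rewrite -EFinD lee_fin /=; have := ler_wpM2l k0 (cP y y0).
by have := ler_wpM2r y0 kc; lra.
Qed.

Lemma mean_multiplier w x y : J x -> x < 1 -> J y -> 1 < y ->
  (forall f, step J f -> \int[mu]_v f v = 1 -> w <= \int[mu]_v (f v * Z v)) ->
  exists b, forall f, step J f -> w - b <= \int[mu]_v (f v * (Z v - b)).
Proof.
move=> Jx x1 Jy y1 wP.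
have [||||b bP] := @multiplier_for_mass _ _ _ mu J (fun=> 0) Z w J_convex _ Zi.
- by move=> *; lra.
- by exists x.
- by exists y.
- by move=> f sf f1; rewrite Rintegral_prob_cst add0r wP.
exists b => f sf; apply: (le_trans (bP f sf)).
by under eq_Rintegral do rewrite add0r.
Qed.

(* Here [J] lies on one side of 1 and the primal optimum is the mean of [Z]. It
   is approached as [b] tends to infinity, with sign that of [1 - k]. *)
Lemma dual_bound_one_sided k (M : \bar R) : 0 <= k -> k != 1 ->
  (forall x, J x -> (1 <= x <= k) || (k <= x <= 1)) ->
  (forall b, exists2 l, 0 <= l & mu.-integrable setT (fun v => Phi psi l b (Z v))) ->
  (forall l b, 0 <= l -> mu.-integrable setT (fun v => Phi psi l b (Z v)) ->
    (b%:E + \int[mu]_v Phi psi l b (Z v) <= M)%E) ->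
  ((\int[mu]_v Z v)%:E <= M)%E.
Proof.
move=> k0 k1 Jk lP MP.
(* For [f] between 1 and [k], the affine expression [f * (z - b) + b] is at least the smaller of its
   end values [z] and [k * z + b * (1 - k)]; [b] is chosen below with [b * (1 - k) = n]. *)
pose m n v := Num.min (Z v) (k * Z v + n%:R).
have kni n : mu.-integrable setT (EFin \o (fun v => k * Z v + n%:R)).
  apply: integrableD_EFin; first exact: integrableZl_EFin.
  exact: finite_measure_integrable_cst.
have mi n : mu.-integrable setT (EFin \o m n).
  apply: (le_integrable measurableT _ _
    (integrableD measurableT (integrable_abse Zi) (integrable_abse (kni n)))).
    apply/measurable_EFinP; apply: measurable_minr => //.
    by apply/measurable_EFinP; exact: measurable_int (kni n).
  move=> v _; rewrite /= lee_fin [leRHS]ger0_norm ?addr_ge0 // /m minEle.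
  by case: ifP => _; rewrite ?lerDl ?lerDr.
have mM n : ((\int[mu]_v m n v)%:E <= M)%E.
  pose b := n%:R / (1 - k); have bk : b * (1 - k) = n%:R.
    by rewrite /b mulfVK // subr_eq0 eq_sym.
  have [l l0 Pi] := lP b.
  apply: (dual_bound l0 Pi _ MP) => f sf.
  rewrite -[X in _ - X](Rintegral_prob_cst mu b) -RintegralB //; last first.
    exact: finite_measure_integrable_cst.
  apply: le_Rintegral => //.
  - by apply: integrableB_EFin => //; exact: finite_measure_integrable_cst.
  - exact: (stepM_integrable (ZBi b) sf).
  - move=> v _; have [_ _ /(_ v)/Jk fk] := sf.
    have : m n v <= Z v by rewrite ge_min lexx.
    have : m n v <= k * Z v + n%:R by rewrite ge_min lexx orbT.
    rewrite -bk; move: (m n v) (Z v) (f v) fk => mm z x fk h1 h2.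
    have [y0|y0] := leP 0 (z - b); case/orP: fk => /andP[] *; nra.
case: M MP mM => [r||] MP mM; rewrite ?leey //; last first.
  by have := mM 0%N.
(* [m n] increases to [Z] and reaches it at each point after finitely many steps; the sign is
   changed to obtain a decreasing sequence. *)
pose u n v := -1 * m n v.
have ui n : mu.-integrable setT (EFin \o u n) by exact: integrableZl_EFin.
have nu n v : u n.+1 v <= u n v.
  rewrite /u !mulN1r lerN2 /m le_min ge_min lexx /= ge_min -natr1 addrA.
  by rewrite lerDl ler01 orbT.
have uG v : (u n v)%:E @[n --> \oo] --> (-1 * Z v)%:E.
  apply: cvg_near_cst; near=> n; rewrite /u /m min_l //.
  rewrite -lerBlDl; near: n; exact: nbhs_infty_ger.
have := nonincreasing_limit_integral ui nu uG (w := - r).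
rewrite -EFin_Rintegral; last exact: integrableZl_EFin.
rewrite RintegralZl // lee_fin mulN1r lerN2; apply => n.
by rewrite RintegralZl // mulN1r lerN2 -lee_fin.
Unshelve. all: by end_near. Qed.

Lemma zero_radius_duality w l b (M : \bar R) : 0 <= l ->
  mu.-integrable setT (fun v => Phi psi l b (Z v)) ->
  (forall f, step J f -> \int[mu]_v f v = 1 -> w <= \int[mu]_v (f v * Z v)) ->
  (forall l b, 0 <= l -> mu.-integrable setT (fun v => Phi psi l b (Z v)) ->
    (b%:E + \int[mu]_v Phi psi l b (Z v) <= M)%E) ->
  (w%:E <= M)%E.
Proof.
move=> l0 Pi wP MP.
have wZ : w <= \int[mu]_v Z v.
  have := wP _ (step_cst J1) (Rintegral_prob_cst mu 1).
  by under eq_Rintegral do rewrite mul1r.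
have [[x [x1 px]]|noX] := pselect (exists x, 1 < x /\ 0 < psi x).
  have lP b' := @Phi_integrable_growth x l b b' x1 px l0 Pi.
  have [[y [Jy y1]]|noY] := pselect (exists y, J y /\ y < 1); last first.
    (* [J] lies in [1, x], because a zero of [psi] beyond [x] would make [psi x] vanish. *)
    apply: (@le_trans _ _ (\int[mu]_v Z v)%:E); first by rewrite lee_fin.
    apply: (@dual_bound_one_sided x M _ _ _ lP MP); [lra|by rewrite gt_eqF|].
    move=> z Jz; have [z1|z1] := ltP z 1; first by exfalso; apply: noY; exists z.
    apply/orP; left; rewrite leNgt; apply/negP => xz.
    have xz1 : (1 <= x <= z) || (z <= x <= 1).
      by apply/orP; left; apply/andP; split; lra.
    by have [_] := J_between Jz xz1; lra.
  have [[z [Jz z1]]|noZ] := pselect (exists z, J z /\ 1 < z); last first.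
    apply: (@le_trans _ _ (\int[mu]_v Z v)%:E); first by rewrite lee_fin.
    apply: (@dual_bound_one_sided 0 M (lexx 0) _ _ lP MP).
      by rewrite eq_sym oner_eq0.
    move=> z Jz; have [z1|z1] := ltP 1 z; first by exfalso; apply: noZ; exists z.
    by case: Jz => -> _; rewrite orbT.
  have [b' bP] := mean_multiplier Jy y1 Jz z1 wP.
  have [l' l'0 Pi'] := lP b'.
  exact: dual_bound l'0 Pi' bP MP.
have J_ge1 x : 1 <= x -> J x.
  move=> x1; have x0 : 0 <= x by lra.
  split => //; apply/eqP; rewrite eq_le psi_ge0 // andbT leNgt; apply/negP => px.
  apply: noX; exists x; split => //; rewrite lt_neqAle x1 andbT.
  by apply/negP => /eqP h; move: px; rewrite -h psi1 ltxx.
have [[y [Jy y1]]|noY] := pselect (exists y, J y /\ y < 1).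
  have J2 : J 2 by apply: J_ge1; lra.
  have [b' bP] := mean_multiplier Jy y1 J2 (ltr1n _ 2) wP.
  (* Growth of [psi] is absent here, so integrability at [b'] is obtained afresh: [I] has integral
     at least [w - b'], hence is integrable, and [I - |Z - b'|] bounds [Phi] at multiplier 0 from
     below. *)
  pose I v := ereal_inf (range (fun n : nat => (0 + n.+1%:R * (Z v - b'))%:E)).
  have II v n : (I v <= (n.+1%:R * (Z v - b'))%:E)%E.
    by apply: ereal_inf_lbound; exists n => //; rewrite add0r.
  have I1 v : (I v <= (Z v - b')%:E)%E by have := II v 0%N; rewrite mul1r.
  have wI : ((w - b')%:E <= \int[mu]_v I v)%E.
    apply: (step_interchange (F := fun=> 0) (X := J) _ (ZBi b')) => [n|f sf].
      by apply: J_ge1; rewrite ler1n.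
    by under eq_Rintegral do rewrite add0r; exact: bP.
  have mI : measurable_fun setT I.
    suff mi : measurable_fun setT
        (fun z : R => ereal_inf (range (fun n : nat => (0 + n.+1%:R * (z - b'))%:E))).
      exact: (measurableT_comp mi mZ).
    apply: nondecreasing_emeasurable => s t st.
    apply: le_ereal_inf_tmp => _ [n _ <-].
    apply: (@le_trans _ _ (0 + n.+1%:R * (s - b'))%:E).
      by apply: ereal_inf_lbound; exists n.
    by rewrite lee_fin !add0r ler_wpM2l ?lerB.
  have Ii := integrable_bounded_above mI (ZBi b') I1 wI.
  have Ai := integrable_abse (ZBi b').
  have Pi' : mu.-integrable setT (fun v => Phi psi 0 b' (Z v)).
    apply: (Phi_integrable_above (integrableB measurableT Ii Ai)) => v.
    apply: le_Phi => x x0; rewrite mul0r add0r.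
    rewrite [leLHS](_ : _ = (I v - `|Z v - b'|%:E)%E) // leeBlDr //.
    have [z0|z0] := leP 0 (Z v - b').
      apply: (le_trans (I1 v)); rewrite ger0_norm // -EFinD lee_fin.
      by rewrite lerDr mulr_ge0.
    apply: (le_trans (II v (Num.truncn x))).
    rewrite -EFinD lee_fin; apply: (@le_trans _ _ (x * (Z v - b'))).
      by rewrite ler_wnM2r ?ltW // truncnS_gt.
    by rewrite lerDl.
  exact: dual_bound (lexx 0) Pi' bP MP.
(* As [J] is unbounded, [Z v < b] would drive [Phi] to -oo, contrary to its integrability. *)
have Zb : {ae mu, forall v, b <= Z v}.
  apply: filterS (integrable_ae measurableT Pi) => v /(_ Logic.I) Pf.
  rewrite leNgt; apply/negP => zb.
  have y0 : Z v - b < 0 by lra.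
  set g := fine (Phi psi l b (Z v)).
  have gP x : 1 <= x -> g <= x * (Z v - b).
    move=> x1; have [x0 px] := J_ge1 x x1.
    have := ge_Phi psi l b (Z v) x0.
    by rewrite px mulr0 add0r -(fineK Pf) lee_fin.
  pose N := (Num.truncn (g / (Z v - b))).+1.
  have N1 : (1 : R) <= N%:R by rewrite ler1n.
  have := gP _ N1; rewrite -ler_ndivlMr // leNgt => /negP; apply.
  exact: truncnS_gt.
apply: (dual_bound l0 Pi _ MP) => f sf.
apply: (@le_trans _ _ (\int[mu]_v (Z v - b))).
  rewrite RintegralB //; last exact: finite_measure_integrable_cst.
  by rewrite Rintegral_prob_cst lerD2r.
have fi := stepM_integrable (ZBi b) sf.
rewrite -subr_ge0 -RintegralB //.
(* Since [f >= 1] and [Z >= b] almost everywhere, the integrand is almost everywhere non-negative;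
   its absolute value is so at every point. *)
have -> : \int[mu]_v (f v * (Z v - b) - (Z v - b))
    = \int[mu]_v `|f v * (Z v - b) - (Z v - b)|.
  have di := integrableB_EFin fi (ZBi b).
  congr fine; apply: ae_eq_integral => //.
  - exact: measurable_int di.
  - exact: measurable_int (integrable_norm di).
  - apply: filterS Zb => v zb _ /=; rewrite ger0_norm //.
    have [_ _ /(_ v) Jf] := sf.
    have [f1|f1] := ltP (f v) 1; first by exfalso; apply: noY; exists (f v).
    by nra.
by apply: Rintegral_ge0.
Qed.

End zero_radius.
End strong_duality.

(** * Reduction to a non-negative [psi], and assembly of the duality *)

Section duality.
Context {R : realType} {d : measure_display} {V : measurableType d}.
Context (mu : probability V R).
Implicit Types (Z : V -> R) (phi : R -> R).

(** The shift of [b] and the added constant compensate in the dual value at radius zero, so [phi]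
    and [psi] have the same dual problem there. *)
Lemma Phi_sub_affine phi s l b z :
  Phi (fun x => phi x - s * (x - 1)) l b z
  = (Phi phi l (b + l * s)%R z + (l * s)%:E)%E.
Proof.
apply/eqP; rewrite eq_le; apply/andP; split.
  rewrite -leeBlDr //; apply: le_Phi => x x0; rewrite leeBlDr //.
  by apply: (le_trans (ge_Phi _ _ _ _ x0)); rewrite -EFinD lee_fin; lra.
apply: le_Phi => x x0; rewrite -leeBrDr //.
by apply: (le_trans (ge_Phi _ _ _ _ x0)); rewrite -EFinB lee_fin; lra.
Qed.

Lemma phi_divergence_duality phi Z delta :
  convex_on [set x | 0 <= x] phi -> phi 1 = 0 -> 0 <= delta ->
  mu.-integrable setT (EFin \o Z) ->
  (forall nu, divergence_ball phi mu delta nu ->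
     nu.-integrable setT (EFin \o Z)) ->
  (delta = 0 -> exists l b, 0 <= l /\
     mu.-integrable setT (fun v => Phi phi l b (Z v))) ->
  ereal_inf [set (\int[nu]_v (Z v)%:E)%E | nu in divergence_ball phi mu delta]
  = ereal_sup [set ((b - l * delta)%:E + \int[mu]_v Phi phi l b (Z v))%E
              | l in [set l : R | 0 <= l] & b in [set: R]].
Proof.
move=> pc p1 d0 Zi ZB zero; apply/eqP; rewrite eq_le; apply/andP; split; last first.
  apply: ge_ereal_sup => _ [l l0 [b _ <-]]; apply: le_ereal_inf_tmp => _ [nu nuB <-].
  exact: weak_duality.
set M := ereal_sup _; set I := ereal_inf _.
have MP l b : 0 <= l ->
    ((b - l * delta)%:E + \int[mu]_v Phi phi l b (Z v) <= M)%E.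
  by move=> l0; apply: ereal_sup_ubound; exists l => //; exists b.
have IP f : step [set x | 0 <= x] f -> \int[mu]_v f v = 1 ->
    \int[mu]_v phi (f v) <= delta -> (I <= (\int[mu]_v (f v * Z v))%:E)%E.
  move=> sf f1 fd; have [nu nuB <-] := step_density_in_ball pc ZB Zi sf f1 fd.
  by apply: ereal_inf_lbound; exists nu.
(* The density 1 belongs to the ball, so the infimum is not +oo; for -oo nothing is to be shown. *)
case: I IP => [w||] IP; last exact: leNye; last first.
  have s1 : step [set x : R | 0 <= x] (fun _ : V => 1 : R) := step_cst ler01.
  by have := IP _ s1 (Rintegral_prob_cst mu 1); rewrite Rintegral_prob_cst p1 => /(_ d0).
have [delta0|delta0] := eqVneq delta 0; last first.
  have [||l [b [l0 wP]]] := @strong_duality_pos _ _ _ mu phi Z w delta pc p1 Zi.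
  - by rewrite lt_neqAle eq_sym delta0.
  - by move=> f sf f1 fd; rewrite -lee_fin; exact: IP.
  exact: le_trans wP (MP l b l0).
have [l [b [l0 Pi]]] := zero delta0.
have [s sP] := convex_minorant pc p1.
pose psi x := phi x - s * (x - 1).
have psi_ge0 x : 0 <= x -> 0 <= psi x by move=> /sP; rewrite subr_ge0.
have psi1 : psi 1 = 0 by rewrite /psi p1; lra.
have ci r := finite_measure_integrable_cst mu r measurableT.
apply: (@zero_radius_duality _ _ _ mu psi Z (convex_sub_affine s pc) psi_ge0 psi1
  Zi w l (b - l * s) M l0) => [|f sf f1|l' b' l'0 Pi'].
- apply: eq_integrable (integrableD measurableT Pi (ci (l * s))) => // v _.
  by rewrite Phi_sub_affine subrK.
- rewrite -lee_fin; apply: IP => //.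
    by apply: step_sub sf => x [].
  have fi := step_integrable mu sf.
  have [_ _ Jf] := sf.
  (* On [J] the function [phi] agrees with [s * (x - 1)], which integrates to 0 along a density of
     mass 1: such an [f] has zero divergence. *)
  have -> : \int[mu]_v phi (f v) = \int[mu]_v (s * (f v - 1)).
    by apply: eq_Rintegral => v _; have [_] := Jf v; rewrite /psi; lra.
  rewrite RintegralZl ?RintegralB //; [|exact: ci|exact: integrableB_EFin fi (ci 1)].
  by rewrite f1 Rintegral_prob_cst subrr mulr0.
- have Pi2 : mu.-integrable setT (fun v => Phi phi l' (b' + l' * s) (Z v)).
    apply: eq_integrable (integrableB measurableT Pi' (ci (l' * s))) => // v _.
    by rewrite /= Phi_sub_affine addeK.
  under eq_integral do rewrite Phi_sub_affine.
  rewrite integralD //; last exact: ci.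
  rewrite integral_cst // [X in ((l' * s)%:E * X)%E](probability_setT mu) mule1.
  rewrite addeA addeAC -EFinD.
  by have := MP l' (b' + l' * s) l'0; rewrite delta0 mulr0 subr0.
Qed.

End duality.

Unset Implicit Arguments.
Set Strict Implicit.

(** The last hypothesis supplies the dominating function used at radius zero. The equality can fail
    otherwise: for [phi x = |x - 1|], [delta = 0] and [Z] essentially unbounded below, every dual
    value is -oo while the primal value is the mean of [Z]. *)
Theorem theoremC1 (R : realType) (d : measure_display)
    (Omega : measurableType d) (P : probability Omega R)
    (m m' n k : nat) (T : R) (T_gt0 : 0 < T)
    (B : {RV P >-> m.-tuple R}) (W : R -> Omega -> m'.-tuple R)
    (W_brownian : brownian_motion P T W)
    (B_indep_W : indep_of_process P T B W)
    (mu : probability (m.-tuple R) R)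
    (B_law : forall A, measurable A -> mu A = distribution P B A)
    (F : R -> set (set Omega)) (F_usual : usual_conditions P T F)
    (F_sub : forall t, 0 <= t <= T -> F t `<=` driving_filtration P B W t)
    (U : set (k.-tuple R)) (x0 : n.-tuple R)
    (a : R -> m.-tuple R -> n.-tuple R -> k.-tuple R -> n.-tuple R)
    (b : R -> m.-tuple R -> n.-tuple R -> k.-tuple R -> 'M[R]_(m', n))
    (g : R -> n.-tuple R -> k.-tuple R -> R) (h : n.-tuple R -> R)
    (pi : R -> Omega -> k.-tuple R) (pi_admissible : admissible P T F U pi)
    (X : R -> Omega -> n.-tuple R)
    (X_sde : solves_sde P T B W F a b x0 pi X)
    (Pb : R.-pker (m.-tuple R) ~> Omega)
    (Pb_rcp : regular_conditional P B mu Pb)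
    (g_int : {ae P, forall w, lebesgue_measure.-integrable `[0, T]%classic
                                (fun t => (g t (X t w) (pi t w))%:E)})
    (payoff_int : {ae mu, forall c,
        completion_integrable (Pb c) (payoff T g h pi X)})
    (phi : R -> R) (phi_convex : convex_function (`[0, +oo[%classic : set R) phi)
    (phi1 : phi 1 = 0) (delta : R) (delta_ge0 : 0 <= delta) :
  let Z := conditional_value Pb (payoff T g h pi X) in
  mu.-integrable setT (EFin \o Z) ->
  divergence_ball phi mu delta !=set0 ->
  (forall nu, divergence_ball phi mu delta nu ->
     nu.-integrable setT (EFin \o Z)) ->
  (delta = 0 -> exists lambda beta : R,
     0 <= lambda /\ mu.-integrable setT (fun c => Phi phi lambda beta (Z c))) ->
  ereal_inf [set (\int[nu]_c (Z c)%:E)%E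
            | nu in divergence_ball phi mu delta]
  = ereal_sup [set ((beta - lambda * delta)%R%:E
                    + \int[mu]_c Phi phi lambda beta (Z c))%E
              | lambda in [set l : R | (0 <= l)%R] & beta in [set: R]].
Proof.
move=> Z Zi _ Z_ball zero.
apply: phi_divergence_duality => // t x y t01 x_ge0 y_ge0.
by apply: (convex_functionP phi_convex) => //; rewrite /= in_itv /= andbT.
Qed.
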